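(* Let $Y=\mathbb{R}^d/\pi$ be a flat manifold with holonomy group $F$, let $k$ be an integer with $\left|k|F|+1\right|>1$, and let $g : Y\to Y$ be the expansive self-cover of $Y$ to which the map $(k|F|+1)I_d : \mathbb{R}^d\to\mathbb{R}^d$ projects. Let $\mathcal{G} = \Omega\rtimes\pi_1(Y)$ be the odometer associated to $Y$ and $g$. Then $\operatorname{dad}(\mathcal{G}) = \dim(Y)$.
   Context: Flat manifold: a manifold $Y = \mathbb{R}^d/\pi$, where $\pi$ is a cocompact, torsion-free, discrete subgroup of $O(d)\ltimes\mathbb{R}^d$ acting freely and properly on $\mathbb{R}^d$; then $\pi = \pi_1(Y)$. There is a short exact sequence $0\to\mathbb{Z}^d\to\pi\to F\to 0$, where $\mathbb{Z}^d$ is the subgroup of pure translations in $\pi$ and the finite group $F$ is the holonomy. By a theorem of Epstein and Shub, for every integer $k$ with $|k|F|+1|>1$ the map $(k|F|+1)I_d$ of $\mathbb{R}^d$ projects to an affine expanding endomorphism $g$ of $Y$, which is a covering map (an expansive self-cover). Such a $g$ has a fixed point, which is used as base point for $\pi_1(Y)$, so $g_* : \pi_1(Y)\to\pi_1(Y)$ is defined (and injective). Odometer: from $(Y,g)$ form the chain of finite index subgroups $\pi_1(Y)\supset g_*\pi_1(Y)\supset g_*^2\pi_1(Y)\supset\cdots$ and the inverse limit $\Omega = \varprojlim \left(\pi_1(Y)/g_*^m\pi_1(Y)\right)$ of the finite sets of left cosets along the natural maps $\pi_1(Y)/g_*^{m+1}\pi_1(Y)\to\pi_1(Y)/g_*^{m}\pi_1(Y)$;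 $\Omega$ is a Cantor set. The discrete group $\pi_1(Y)$ acts on $\Omega$ by multiplication on coset representatives, and the odometer is the action (transformation) groupoid $\mathcal{G}=\Omega\rtimes\pi_1(Y)$. Dynamic asymptotic dimension: for a locally compact Hausdorff étale groupoid $\mathcal{G}$ with source and range maps $s,r$, $\operatorname{dad}(\mathcal{G})$ is the smallest integer $d\ge 0$ such that for every open relatively compact subset $K\subseteq\mathcal{G}$ there are open subsets $U_0,\dots,U_d$ of $\mathcal{G}^{(0)}$ covering $s(K)\cup r(K)$ such that for each $i$ the set $\{\gamma\in K : s(\gamma),r(\gamma)\in U_i\}$ is contained in a relatively compact subgroupoid of $\mathcal{G}$ (and $\operatorname{dad}(\mathcal{G})=\infty$ if no such $d$ exists). *)

(* Defs.v *)
From HB Require Import structures.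
From mathcomp Require Import all_boot all_order all_algebra.
From mathcomp Require Import finmap.
From mathcomp Require Import all_classical all_reals all_analysis.

Set Implicit Arguments.
Unset Strict Implicit.
Unset Printing Implicit Defensive.

Import Order.TTheory GRing.Theory Num.Theory.
Import numFieldNormedType.Exports.
Local Open Scope classical_set_scope.
Local Open Scope ring_scope.

(* [gmul a b] is the composite "b, then a"; it is meaningful only when
   [gsrc a = grng b], and its other values are junk. *)
Record topGroupoid := TopGroupoid {
  gobj : topologicalType;
  garr : topologicalType;
  gsrc : garr -> gobj;
  grng : garr -> gobj;
  gid : gobj -> garr;
  ginv : garr -> garr;
  gmul : garr -> garr -> garr;
  gsrc_id : forall x, gsrc (gid x) = x;
  grng_id : forall x, grng (gid x) = x;
  gsrc_inv : forall a, gsrc (ginv a) = grng a;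
  grng_inv : forall a, grng (ginv a) = gsrc a;
  gsrc_mul : forall a b, gsrc a = grng b -> gsrc (gmul a b) = gsrc b;
  grng_mul : forall a b, gsrc a = grng b -> grng (gmul a b) = grng a;
  gmulA : forall a b c, gsrc a = grng b -> gsrc b = grng c ->
    gmul a (gmul b c) = gmul (gmul a b) c;
  gmul1 : forall a, gmul a (gid (gsrc a)) = a;
  g1mul : forall a, gmul (gid (grng a)) a = a;
  gmulV : forall a, gmul a (ginv a) = gid (grng a);
  gVmul : forall a, gmul (ginv a) a = gid (gsrc a);
  gsrc_continuous : continuous gsrc;
  grng_continuous : continuous grng;
  gid_continuous : continuous gid;
  ginv_continuous : continuous ginv;
  gmul_continuous : {within [set p : garr * garr | gsrc p.1 = grng p.2],
    continuous (fun p : garr * garr => gmul p.1 p.2)}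
}.

Definition subgroupoid (G : topGroupoid) (H : set (garr G)) :=
  (forall a, H a -> H (ginv a)) /\
  (forall a b, H a -> H b -> gsrc a = grng b -> H (gmul a b)).

(* Usually stated for locally compact Hausdorff etale groupoids; the condition
   itself only involves the topological groupoid structure. *)
Definition dad_le (G : topGroupoid) (n : nat) : Prop :=
  forall K : set (garr G), open K -> precompact K ->
  exists U : 'I_n.+1 -> set (gobj G),
    [/\ forall i, open (U i),
        (@gsrc G @` K) `|` (@grng G @` K) `<=` \bigcup_i U i &
        forall i, exists H : set (garr G),
          [/\ subgroupoid H, precompact H &
              [set a | [/\ K a, U i (gsrc a) & U i (grng a)]] `<=` H]].

Lemma dad_le_asbool (G : topGroupoid) :
  (exists n, dad_le G n) -> exists n, `[< dad_le G n >].
Proof. by move=> [n /asboolP ?]; exists n. Qed.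

(* [None] stands for infinity. *)
Definition dad (G : topGroupoid) : option nat :=
  if pselect (exists n, dad_le G n) is left h
  then Some (ex_minn (dad_le_asbool h)) else None.

Lemma discrete_prod_continuous (D : choiceType) (X Z : topologicalType)
    (f : discrete_topology D * X -> Z) :
  (forall g : D, continuous (fun x => f (g, x))) -> continuous f.
Proof.
move=> cf [g x] A /(cf g x) fA.
exists ([set g], [set y | A (f (g, y))]).
  by split; [exact: discrete_set1 | exact: fA].
by move=> [h y] /= [->].
Qed.

Lemma pair_continuous (X Y Z : topologicalType) (f : X -> Y) (h : X -> Z) :
  continuous f -> continuous h -> continuous (fun x => (f x, h x)).
Proof.
move=> cf ch x A [[B C] /= [fB hC] BC].
have {}fB : \forall y \near x, B (f y) := cf x _ fB.
have {}hC : \forall y \near x, C (h y) := ch x _ hC.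
by apply: filterS2 fB hC => y ? ?; exact: BC.
Qed.

(* Transformation groupoid of a discrete group acting on a space: the arrow
   (g, x) goes from x to g x. *)
Section transformation_groupoid.
Variables (Gam : groupType) (X : topologicalType) (act : Gam -> X -> X).
Hypothesis act1 : forall x, act 1%g x = x.
Hypothesis actM : forall g h x, act (g * h)%g x = act g (act h x).
Hypothesis act_continuous : forall g, continuous (act g).

Let arr : topologicalType := (discrete_topology Gam * X)%type.
Let src (a : arr) : X := a.2.
Let rng (a : arr) : X := act (a.1 : Gam) a.2.
Let one (x : X) : arr := (1%g : Gam, x).
Let inv (a : arr) : arr := ((a.1 : Gam)^-1%g : Gam, act (a.1 : Gam) a.2).
Let mul (a b : arr) : arr := ((a.1 : Gam) * (b.1 : Gam) : Gam, b.2)%g.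

Let rng_continuous : continuous rng.
Proof. exact: discrete_prod_continuous act_continuous. Qed.

Let inv_continuous : continuous inv.
Proof.
apply: discrete_prod_continuous => g.
apply: (@pair_continuous X (discrete_topology Gam) X (fun=> g^-1%g) (act g)).
  exact: cst_continuous.
exact: act_continuous.
Qed.

Let one_continuous : continuous one.
Proof.
apply: (@pair_continuous X (discrete_topology Gam) X (fun=> 1%g) id).
  exact: cst_continuous.
by move=> x; exact: cvg_id.
Qed.

Let mul_continuous : continuous (fun p : arr * arr => mul p.1 p.2).
Proof.
move=> [[g x] [h y]] A [[B C] /= [gB yC] BC].
exists ([set a : arr | a.1 = g], [set a : arr | a.1 = h /\ C a.2]) => /=.
  split; last by exists ([set h], C); [split=> //; exact: discrete_set1|].
  exists ([set g], setT); last by move=> [? ?] [].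
  by split; [exact: discrete_set1 | exact: filterT].
move=> [[g' x'] [h' y']] /= [-> [-> Cy]]; apply: BC; split => //=.
exact: nbhs_singleton gB.
Qed.

Let src_id x : src (one x) = x. Proof. by []. Qed.
Let rng_id x : rng (one x) = x. Proof. exact: act1. Qed.
Let src_inv a : src (inv a) = rng a. Proof. by []. Qed.
Let rng_inv a : rng (inv a) = src a.
Proof. by rewrite /rng /= -actM mulVg act1. Qed.
Let src_mul a b : src a = rng b -> src (mul a b) = src b. Proof. by []. Qed.
Let rng_mul a b : src a = rng b -> rng (mul a b) = rng a.
Proof. by rewrite /src /rng /= => ->; rewrite actM. Qed.
Let mulA a b c : src a = rng b -> src b = rng c ->
  mul a (mul b c) = mul (mul a b) c.
Proof. by rewrite /mul /= mulgA. Qed.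
Let mul1 a : mul a (one (src a)) = a.
Proof. by case: a => g x; rewrite /mul /= mulg1. Qed.
Let onem a : mul (one (rng a)) a = a.
Proof. by case: a => g x; rewrite /mul /= mul1g. Qed.
Let mulV a : mul a (inv a) = one (rng a).
Proof. by rewrite /mul /= mulgV. Qed.
Let Vmul a : mul (inv a) a = one (src a).
Proof. by rewrite /mul /= mulVg. Qed.
Let src_continuous : continuous src. Proof. by move=> a; exact: cvg_snd. Qed.

Definition transformation_groupoid : topGroupoid :=
  TopGroupoid src_id rng_id src_inv rng_inv src_mul rng_mul mulA mul1 onem
    mulV Vmul src_continuous rng_continuous one_continuous inv_continuous
    (continuous_subspaceT mul_continuous).

End transformation_groupoid.

Definition left_coset (Gam : groupType) (H : set Gam) (x : Gam) : set Gam :=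
  [set (x * h)%g | h in H].

Definition coset_space (Gam : groupType) (H : set Gam) : set (set Gam) :=
  range (left_coset H).

Section odometer.
Variables (Gam : groupType) (phi : Gam -> Gam).

Definition tower (m : nat) : set Gam := range (iter m phi).

(* The sequences of cosets that are compatible with the natural maps
   x phi^(m+1)(Gam) |-> x phi^m(Gam). *)
Definition odometer_seq :
    set (prod_topology (fun _ : nat => discrete_topology (set Gam))) :=
  [set w | forall m, exists x : Gam,
     w m = left_coset (tower m) x /\ w m.+1 = left_coset (tower m.+1) x].

Definition odometer_space : topologicalType := set_type odometer_seq.

Definition translate (g : Gam) (A : set Gam) : set Gam :=
  [set (g * a)%g | a in A].

Lemma translate_coset g H x :
  translate g (left_coset H x) = left_coset H (g * x)%g.
Proof.
by rewrite /translate /left_coset image_comp; apply: eq_imagel => h _ /=;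
  rewrite mulgA.
Qed.

Lemma translate_odometer g (w : odometer_space) :
  (fun m => translate g (val w m)) \in odometer_seq.
Proof.
apply/mem_set => m; have [x [e1 e2]] := set_valP w m.
by exists (g * x)%g; rewrite /= e1 e2 !translate_coset.
Qed.

Definition odometer_act (g : Gam) (w : odometer_space) : odometer_space :=
  SigSub (translate_odometer g w).

Lemma odometer_act1 w : odometer_act 1%g w = w.
Proof.
apply/val_inj/funext => m /=; rewrite /translate.
by under eq_imagel do rewrite mul1g; rewrite image_id.
Qed.

Lemma odometer_actM g h w :
  odometer_act (g * h)%g w = odometer_act g (odometer_act h w).
Proof.
apply/val_inj/funext => m /=; rewrite /translate image_comp.
by apply: eq_imagel => a _ /=; rewrite mulgA.
Qed.

Lemma odometer_act_continuous g : continuous (odometer_act g).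
Proof.
apply: (@continuous_comp_initial _ odometer_space _ set_val) => w.
have FF : Filter ((set_val \o odometer_act g) @ nbhs w) by exact: fmap_filter.
apply/cvg_sup => m A [_ [[B oB <-] Bw]] BA.
have : nbhs (w : odometer_space) [set v : odometer_space | val v m = val w m].
  have /= := @proj_continuous nat (fun=> discrete_topology (set Gam)) m (val w).
  move=> /(_ [set val w m] (discrete_set1 _)) wm.
  exact: (@initial_continuous odometer_space _ set_val w _ wm).
apply: filterS => v vw; apply: BA.
by change (B (translate g (val v m))); rewrite vw; exact: Bw.
Qed.

End odometer.

Definition odometer (Gam : groupType) (phi : Gam -> Gam) : topGroupoid :=
  transformation_groupoid (@odometer_act1 Gam phi) (@odometer_actM Gam phi)
    (@odometer_act_continuous Gam phi).

Section eisom.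
Variables (R : realType) (d : nat).

(* O(d) |>< R^d; the pair (A, v) acts as x |-> A x + v. *)
Record eisom := EIsom {
  eisom_pair : 'M[R]_d * 'cV[R]_d;
  eisom_orthogonal : eisom_pair.1 *m eisom_pair.1^T == 1%:M
}.

HB.instance Definition _ := [isSub for eisom_pair].
HB.instance Definition _ := [Choice of eisom by <:].
HB.instance Definition _ :=
  Topological.copy eisom (initial_topology eisom_pair).

Definition eisom_linear (p : eisom) : 'M[R]_d := (eisom_pair p).1.
Definition eisom_trans (p : eisom) : 'cV[R]_d := (eisom_pair p).2.

Lemma eisom_mulmxT p : eisom_linear p *m (eisom_linear p)^T = 1%:M.
Proof. exact/eqP/eisom_orthogonal. Qed.

Lemma eisom_mulTmx p : (eisom_linear p)^T *m eisom_linear p = 1%:M.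
Proof. exact/mulmx1C/eisom_mulmxT. Qed.

Lemma eisom_one_subproof :
  let p := (1%:M : 'M[R]_d, 0 : 'cV[R]_d) in p.1 *m p.1^T == 1%:M.
Proof. by rewrite /= trmx1 mulmx1. Qed.

Lemma eisom_inv_subproof (p : eisom) :
  let q := ((eisom_linear p)^T, - ((eisom_linear p)^T *m eisom_trans p)) in
  q.1 *m q.1^T == 1%:M.
Proof. by rewrite /= trmxK eisom_mulTmx. Qed.

Lemma eisom_mul_subproof (p q : eisom) :
  let r := (eisom_linear p *m eisom_linear q,
            eisom_linear p *m eisom_trans q + eisom_trans p) in
  r.1 *m r.1^T == 1%:M.
Proof.
by rewrite /= trmx_mul mulmxA -(mulmxA _ _ (eisom_linear q)^T) eisom_mulmxT
  mulmx1 eisom_mulmxT.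
Qed.

Definition eisom_one := EIsom eisom_one_subproof.
Definition eisom_inv p := EIsom (eisom_inv_subproof p).
Definition eisom_mul p q := EIsom (eisom_mul_subproof p q).

Lemma eisom_mulA : associative eisom_mul.
Proof.
move=> p q r; apply/val_inj; congr (_, _) => /=; first exact: mulmxA.
by rewrite /eisom_trans /= mulmxDr mulmxA addrA.
Qed.

Lemma eisom_mul1 : left_id eisom_one eisom_mul.
Proof.
move=> p; apply/val_inj; rewrite /= /eisom_linear /eisom_trans /= !mul1mx addr0.
by case: (eisom_pair p).
Qed.

Lemma eisom_1mul : right_id eisom_one eisom_mul.
Proof.
move=> p; apply/val_inj; rewrite /= /eisom_linear /eisom_trans /= mulmx1 mulmx0.
by rewrite add0r; case: (eisom_pair p).
Qed.

Lemma eisom_mulV : left_inverse eisom_one eisom_inv eisom_mul.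
Proof.
by move=> p; apply/val_inj; congr (_, _); [exact: eisom_mulTmx | exact: subrr].
Qed.

Lemma eisom_Vmul : right_inverse eisom_one eisom_inv eisom_mul.
Proof.
move=> p; apply/val_inj; congr (_, _); first exact: eisom_mulmxT.
by rewrite [eisom_trans _]/= mulmxN mulmxA eisom_mulmxT mul1mx addNr.
Qed.

HB.instance Definition _ :=
  isGroup.Build eisom eisom_mulA eisom_mul1 eisom_1mul eisom_mulV eisom_Vmul.

Definition eisom_act (p : eisom) (x : 'cV[R]_d) : 'cV[R]_d :=
  eisom_linear p *m x + eisom_trans p.

Lemma eisom_act1 x : eisom_act 1%g x = x.
Proof. by rewrite /eisom_act /eisom_linear /eisom_trans /= mul1mx addr0. Qed.

Lemma eisom_actM p q x : eisom_act (p * q)%g x = eisom_act p (eisom_act q x).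
Proof. by rewrite /eisom_act /= mulmxDr mulmxA addrA. Qed.

End eisom.

Section orbit_space.
Local Open Scope quotient_scope.
Variables (R : realType) (d : nat) (S : groupClosed (eisom R d)).

Definition same_orbit (x y : 'cV[R]_d) : bool :=
  `[< exists2 p : eisom R d, p \in S & y = eisom_act p x >].

Lemma same_orbit_refl : reflexive same_orbit.
Proof. by move=> x; apply/asboolP; exists 1%g; rewrite ?gpred1 ?eisom_act1. Qed.

Lemma same_orbit_sym : symmetric same_orbit.
Proof.
suff h x y : same_orbit x y -> same_orbit y x.
  by move=> x y; apply/idP/idP; exact: h.
move=> /asboolP[p Sp ->]; apply/asboolP; exists p^-1%g; first by rewrite gpredV.
by rewrite -eisom_actM mulVg eisom_act1.
Qed.

Lemma same_orbit_trans : transitive same_orbit.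
Proof.
move=> y x z /asboolP[p Sp ->] /asboolP[q Sq ->]; apply/asboolP.
by exists (q * p)%g; [exact: gpredM | rewrite eisom_actM].
Qed.

Definition same_orbit_equiv : equiv_rel 'cV[R]_d :=
  EquivRel same_orbit same_orbit_refl same_orbit_sym same_orbit_trans.

Definition orbit_space : topologicalType :=
  quotient_topology {eq_quot same_orbit_equiv}.

Definition orbit_proj (x : 'cV[R]_d) : orbit_space :=
  \pi_({eq_quot same_orbit_equiv}) x.

End orbit_space.

Section flat_manifold.
Variables (R : realType) (d : nat).

(* The carrier of a flat manifold is [fm_space] below, the quotient of R^d by
   [deck]; its dimension is d. *)
Record flat_manifold := FlatManifold {
  deck : groupClosed (eisom R d);
  deck_discrete : isolated [set` deck] = [set` deck];
  deck_cocompact : compact [set: orbit_space deck];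
  deck_torsion_free : forall (p : eisom R d) (n : nat),
    p \in deck -> (0 < n)%N -> (p ^+ n)%g = 1%g -> p = 1%g;
  deck_free : forall (p : eisom R d) (x : 'cV[R]_d),
    p \in deck -> eisom_act p x = x -> p = 1%g;
  deck_proper : forall K : set 'cV[R]_d, compact K ->
    finite_set [set p : eisom R d |
      p \in deck /\ (eisom_act p @` K) `&` K !=set0]
}.

Definition fm_dim (Y : flat_manifold) : nat := d.

Variable Y : flat_manifold.

Definition fm_space : topologicalType := orbit_space (deck Y).
Definition fm_proj : 'cV[R]_d -> fm_space := @orbit_proj R d (deck Y).

Record fm_pi1 := FmPi1 { pi1_eisom : eisom R d; _ : pi1_eisom \in deck Y }.

HB.instance Definition _ := [isSub for pi1_eisom].
HB.instance Definition _ := [Choice of fm_pi1 by <:].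

Lemma fm_pi1_closed : group_closed (mem (deck Y)).
Proof. by split; [exact: gpred1 | exact: gpredF]. Qed.

HB.instance Definition _ :=
  SubChoice_isSubGroup.Build (eisom R d) (mem (deck Y)) fm_pi1 fm_pi1_closed.

Definition fm_act (p : fm_pi1) (x : 'cV[R]_d) : 'cV[R]_d :=
  eisom_act (pi1_eisom p) x.

Definition fm_translations : set fm_pi1 :=
  [set p | eisom_linear (pi1_eisom p) = 1%:M].

(* The holonomy F, as the set of cosets of the translation subgroup. *)
Definition fm_holonomy : set (set fm_pi1) := coset_space fm_translations.

(* [fm_holonomy] is finite by Bieberbach's theorem. *)
Definition fm_holonomy_order : nat := #|` fset_set fm_holonomy|.

(* [phi] is the endomorphism g_* of pi_1 based at the fixed point
   [fm_proj x0] of g.  The choice of [x0] identifies pi_1 with the deck group,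
   and then g_* is read off on the lift [gl] of g that fixes [x0]. *)
Definition is_pi1_map (g : fm_space -> fm_space) (x0 : 'cV[R]_d)
    (phi : fm_pi1 -> fm_pi1) : Prop :=
  exists gl : 'cV[R]_d -> 'cV[R]_d,
    [/\ continuous gl,
        forall x, fm_proj (gl x) = g (fm_proj x),
        gl x0 = x0 &
        forall p x, gl (fm_act p x) = fm_act (phi p) (gl x)].

End flat_manifold.

(* Main.v *)
(* The odometer space is compact, so a precompact set of arrows involves only
   finitely many group elements, and the piece of a subset U of Omega containing
   a point w may be followed inside the group, hence inside R^d.

   Upper bound.  R^d is a union of d + 1 deck-invariant sets whose eps-separated
   pieces have bounded diameter: bricks give this on small balls, and a fine
   family is absorbed into a coarse one.  The coset p g_*^m(pi) is sent to the
   deck orbit of gl^(-m) (p^-1 0), where gl is the lift of g.  As gl^(-m)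
   contracts, for m large the given finitely many elements of pi move the points
   by less than eps, so the chains they form stay in one piece.

   Lower bound.  Following the orbit of one point of Omega, n + 1 open sets give
   a colouring of the lattice points by n + 1 colours with bounded pieces.
   Sending each point to a representative of its piece is a map F at bounded
   distance from the identity.  If n + 1 <= d, each Kuhn simplex has two vertices
   in one piece, so the determinants of the increments of F vanish.  But
   their signed sum is that of the identity up to a boundary term, by Stokes. *)

Require Import Defs.
From HB Require Import structures.
From mathcomp Require Import all_boot all_order all_algebra all_fingroup.
From mathcomp Require Import zify ring lra.
From mathcomp Require Import all_classical all_reals all_analysis.

Set Implicit Arguments.
Unset Strict Implicit.
Unset Printing Implicit Defensive.

Import Order.TTheory GRing.Theory Num.Theory.
Import numFieldNormedType.Exports.
Local Open Scope classical_set_scope.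
Local Open Scope ring_scope.

(** * Kuhn simplices on a discrete torus *)

Section difference_determinant.
Variables (R : comRingType) (n : nat) (f : nat -> 'I_n -> R).

Definition diff_mx : 'M[R]_n := \matrix_(j, c) (f j.+1 c - f j c).

Let aug : 'M[R]_n.+1 := \matrix_(i, j) (if unlift ord0 j is Some c then f i c else 1).

Let det_aug : \det aug =
  \sum_(i < n.+1) (-1) ^+ i * \det (\matrix_(r < n, c < n) f (lift i r) c).
Proof.
rewrite (expand_det_col _ ord0); apply: eq_bigr => i _.
rewrite mxE unlift_none mul1r /cofactor addn0; congr (_ * \det _).
by apply/matrixP => r c; rewrite !mxE liftK.
Qed.

Let det_aug_diff : \det aug = \det diff_mx.
Proof.
(* The unitriangular [T] takes partial sums of rows; the rows of [B] are the first row of [aug]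
   followed by consecutive differences. *)
pose T : 'M[R]_n.+1 := \matrix_(i, j) (j <= i)%N%:R.
pose B : 'M[R]_n.+1 := \matrix_(i, j)
  (if unlift ord0 j is Some c then
     (if unlift ord0 i is Some r then f r.+1 c - f r c else f 0%N c)
   else (i == ord0)%:R).
have -> : aug = T *m B.
  apply/matrixP => i j; rewrite !mxE big_ord_recl !mxE leq0n mul1r.
  rewrite [unlift ord0 ord0]unlift_none eqxx.
  case: (unliftP ord0 j) => [c ->|->]; last first.
    rewrite big1 ?addr0 // => k _.
    by rewrite !mxE unlift_none mulr0.
  case: i => i /= lt_i; elim: i lt_i => [|i IH] lt_i.
    by rewrite big1 ?addr0 // => k _; rewrite !mxE mul0r.
  have lt_i' : (i < n)%N by [].
  have -> : f i.+1 c = f i c + (f i.+1 c - f i c) by rewrite addrC subrK.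
  rewrite {1}(IH (ltnW lt_i)) -addrA; congr (_ + _).
  rewrite (bigD1 (Ordinal lt_i')) //= [RHS](bigD1 (Ordinal lt_i')) //= !mxE !liftK /=.
  rewrite /bump /= !add1n leqnn ltnn mul0r add0r mul1r addrC; congr (_ + _).
  apply: eq_bigr => k /eqP ki; rewrite !mxE /= /bump /= !add1n ltnS.
  rewrite liftK [RHS in _ = RHS * _]/= [in RHS]leq_eqVlt.
  by case: eqP => //= h; case: ki; exact: val_inj.
rewrite det_mulmx det_trig.
  rewrite big1 ?mul1r => [|i _]; last by rewrite mxE leqnn.
  rewrite (expand_det_col B ord0) big_ord_recl big1 ?addr0 => [|i _].
    rewrite mxE unlift_none eqxx mul1r /cofactor addn0 expr0 mul1r; congr (\det _).
    by apply/matrixP => r c; rewrite !mxE !liftK.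
  by rewrite mxE unlift_none mul0r.
by apply/is_trig_mxP => i j lt_ij; rewrite mxE leqNgt lt_ij.
Qed.

(** The determinant of [aug], which is bordered by a column of ones, is computed twice: by row
    differences and by expansion along the ones. This writes the determinant of a simplex as a
    signed sum over its faces, the form that Stokes needs. *)
Lemma det_diff_mx : \det diff_mx =
  \sum_(i < n.+1) (-1) ^+ i * \det (\matrix_(r < n, c < n) f (lift i r) c).
Proof. by rewrite -det_aug_diff det_aug. Qed.

(** A repeated vertex gives [aug] two equal rows. *)
Lemma det_diff_mx0 (a b : 'I_n.+1) : a != b -> f a = f b -> \det diff_mx = 0.
Proof.
move=> ab fab; rewrite -det_aug_diff; apply: (determinant_alternate ab) => j.
by rewrite !mxE fab.
Qed.

End difference_determinant.

Section kuhn_simplices.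
Variables (n : nat) (V : finZmodType) (e : 'I_n.+1 -> V).

(** The path from [y] that takes the directions in the order given by [s]; its vertices are those of
    a Kuhn simplex. *)
Definition kuhn_vertex (s : 'S_n.+1) (y : V) (j : nat) : V :=
  y + \sum_(i < n.+1 | (i < j)%N) e (s i).

Variable w : ('I_n.+1 -> V) -> int.

Let face (i : 'I_n.+2) (s : 'S_n.+1) y := w (fun r => kuhn_vertex s y (lift i r)).
Let total i := \sum_(s : 'S_n.+1) \sum_y (-1) ^+ s * face i s y.

Let total_inner (i : 'I_n.+2) : (0 < i < n.+1)%N -> total i = 0.
Proof.
move=> /andP[i0 iN].
have lt_a : (i.-1 < n.+1)%N by lia.
(* Exchanging the directions at places i - 1 and i moves only the vertex that face [i] omits, and
   reverses the sign. *)
pose t : 'S_n.+1 := tperm (Ordinal lt_a) (Ordinal iN).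
have neq_ab : Ordinal lt_a != Ordinal iN.
  by apply/eqP => /(congr1 val) /=; lia.
have vE (s : 'S_n.+1) y (j : nat) : j != i ->
    kuhn_vertex (t * s)%g y j = kuhn_vertex s y j.
  move=> ji; rewrite /kuhn_vertex; congr (_ + _).
  rewrite [RHS](reindex_inj (@perm_inj _ t)) /=; apply: eq_big => [k|k _].
    rewrite /t; case: tpermP => [->|->|] //=; apply/idP/idP => //; move/eqP in ji; lia.
  by rewrite permM.
suff : total i = - total i by lia.
rewrite {1}/total (reindex_inj (mulgI t)) /= /total -sumrN; apply: eq_bigr => s _.
rewrite -sumrN; apply: eq_bigr => y _.
rewrite odd_permM odd_tperm neq_ab signr_addb expr1 mulN1r mulNr; congr (- (_ * _)).
congr w; apply/funext => r; apply: vE.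
by rewrite eq_sym; exact: neq_lift.
Qed.

Let total_outer : total ord0 = - (-1) ^+ n.+1 * total ord_max.
Proof.
(* [c] rotates the order of the directions: the path of [s] from [y] without its first vertex is the
   rotated path from [y + e (s ord0)] without its last vertex. *)
pose c : 'S_n.+1 := lift_perm ord_max ord0 1.
have oc : odd_perm c = odd n.
  by rewrite odd_lift_perm odd_perm1 !addbF.
rewrite {2}/total (reindex_inj (mulgI c)) /= mulr_sumr; apply: eq_bigr => s _.
rewrite [in RHS](reindex_inj (addIr (e (s ord0)))) /= mulr_sumr; apply: eq_bigr => y _.
rewrite odd_permM oc signr_addb signr_odd exprS mulN1r opprK.
rewrite !mulrA -expr2 sqrr_sign mul1r; congr (_ * w _); apply/funext => r.
rewrite /kuhn_vertex lift0 lift_max -addrA; congr (_ + _).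
rewrite big_mkcond big_ord_recl /=; congr (_ + _).
rewrite [RHS]big_mkcond [RHS]big_ord_recr /= ltnNge -ltnS ltn_ord /= addr0.
apply: eq_bigr => k _; rewrite /bump /= add1n ltnS.
case: ifP => // _; rewrite permM; congr (e (s _)).
have -> : widen_ord (leqnSn n) k = lift ord_max k.
  by apply: val_inj; rewrite /= /bump leqNgt ltn_ord.
by rewrite lift_perm_lift perm1.
Qed.

(* Stokes on the torus: inner faces cancel in pairs under transposition of two
   consecutive directions, outer ones under cyclic rotation and translation. *)
Lemma kuhn_stokes :
  \sum_(s : 'S_n.+1) \sum_y (-1) ^+ s *
    \sum_(i < n.+2) (-1) ^+ i * w (fun r => kuhn_vertex s y (lift i r)) = 0.
Proof.
have -> : \sum_(s : 'S_n.+1) \sum_y (-1) ^+ s *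
    \sum_(i < n.+2) (-1) ^+ i * w (fun r => kuhn_vertex s y (lift i r)) =
    \sum_(i < n.+2) (-1) ^+ i * total i.
  under [RHS]eq_bigr do rewrite mulr_sumr; rewrite [RHS]exchange_big /=.
  apply: eq_bigr => s _; under [RHS]eq_bigr do rewrite mulr_sumr.
  rewrite [RHS]exchange_big /=; apply: eq_bigr => y _; rewrite mulr_sumr.
  by apply: eq_bigr => i _; rewrite !mulrA [_ * (-1) ^+ i]mulrC.
rewrite big_ord_recl big_ord_recr big1 /= => [|i _]; last first.
  by rewrite total_inner ?mulr0 //= /bump /= add1n ltnS ltn_ord.
rewrite expr0 mul1r add0r total_outer.
have -> : lift ord0 ord_max = ord_max :> 'I_n.+2 by apply: val_inj.
by rewrite mulNr addNr.
Qed.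

End kuhn_simplices.

Lemma kuhn_sum_det (n : nat) (V : finZmodType) (e : 'I_n.+1 -> V)
    (F : V -> 'I_n.+1 -> int) :
  \sum_(s : 'S_n.+1) \sum_y
    (-1) ^+ s * \det (diff_mx (fun j => F (kuhn_vertex e s y j))) = 0.
Proof.
rewrite -[RHS](kuhn_stokes e (fun v => \det (\matrix_(r, c) F (v r) c))).
by apply: eq_bigr => s _; apply: eq_bigr => y _; rewrite det_diff_mx.
Qed.

Lemma normr_det_le (n : nat) (M : 'M[int]_n) (B : int) :
  (forall i j, `|M i j| <= B) -> `|\det M| <= n`!%:R * B ^+ n.
Proof.
move=> MB; apply: le_trans (ler_norm_sum _ _ _) _.
rewrite -card_Sn mulr_natl -sumr_const; apply: ler_sum => s _.
rewrite normrM normr_sign mul1r normr_prod -[n in B ^+ n]card_ord -prodr_const.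
by apply: ler_prod => i _; rewrite normr_ge0 MB.
Qed.

Lemma card_ffun_fixed (n N : nat) (i : 'I_n.+1) (v : 'I_N) :
  #|[set f : {ffun 'I_n.+1 -> 'I_N} | f i == v]%SET| = (N ^ n)%N.
Proof.
pose T (k : 'I_n.+1) : pred 'I_N := if k == i then pred1 v else predT.
have -> : #|[set f : {ffun 'I_n.+1 -> 'I_N} | f i == v]%SET| = #|family T|.
  apply: eq_card => f; rewrite !inE; apply/eqP/familyP => [fi k|/(_ i)].
    by rewrite /T; case: eqP => [->|_]; rewrite inE ?fi.
  by rewrite /T eqxx inE => /eqP.
rewrite card_family foldrE big_image /= (bigD1 i) //= /T eqxx card1 mul1n.
rewrite (eq_bigr (fun=> N)) => [|k /negbTE ->]; last by rewrite card_ord.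
by rewrite prod_nat_const cardC1 card_ord.
Qed.

HB.instance Definition _ (aT : finType) (rT : finZmodType) :=
  GRing.Zmodule.on {ffun aT -> rT}.

Section no_small_collapse.
Variables (n D : nat) (F : ('I_n.+1 -> nat) -> 'I_n.+1 -> int).

(** The Kuhn path in coordinates: direction [c] is taken at place [s^-1 c], so vertex [j] has it
    once [s^-1 c < j]. *)
Definition grid_vertex (s : 'S_n.+1) (y : 'I_n.+1 -> nat) (j : nat) :
    'I_n.+1 -> nat :=
  fun c => (y c + ((s^-1)%g c < j)%N)%N.

Hypothesis F_near : forall x c, `|F x c - (x c)%:Z| <= D%:Z.
Hypothesis F_collapse : forall (s : 'S_n.+1) y, exists a b : 'I_n.+2,
  a != b /\ F (grid_vertex s y a) = F (grid_vertex s y b).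

(** Bounds the determinant of a cell: increments of [F] are at most 1 + 2D in each entry, and the
    Leibniz formula has (n+1)! terms. *)
Let C := ((n.+1)`! * (2 * D + 1) ^ n.+1)%N.
Variable K : nat.
(** Side of the torus: the values [1..K+1], where [F] is used, and the three outer values [0],
    [K+2], [K+3]. Only cells starting at [K+3] wrap around. *)
Let N := K.+3.+1.
Let NE : N = K.+4. Proof. by []. Qed.
Let V := {ffun 'I_n.+1 -> 'I_N}.
Let coords (y : V) : 'I_n.+1 -> nat := fun c => y c.
Let e (a : 'I_n.+1) : V := [ffun c => inZp (c == a)].

Let kvE s (y : V) j c :
  kuhn_vertex e s y j c = ((y c + ((s^-1)%g c < j)) %% N)%N :> nat.
Proof.
have -> : kuhn_vertex e s y j c = y c + inZp ((s^-1)%g c < j)%N.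
  rewrite ffunE sum_ffunE; congr (_ + _).
  have [cj|cj] := boolP ((s^-1)%g c < j)%N.
    rewrite (bigD1 ((s^-1)%g c)) //= ffunE permKV eqxx big1 ?addr0 // => k.
    move=> /andP[_ kc]; rewrite ffunE; case: eqP => [h|_].
      by rewrite h permK eqxx in kc.
    exact: val_inj.
  rewrite big1 => [|k kj]; first exact: val_inj.
  rewrite ffunE; case: eqP => [h|_]; last exact: val_inj.
  by rewrite h permK kj in cj.
by rewrite /= modnDmr.
Qed.

Let inside (v : V) := [forall c, (0 < v c <= K.+1)%N].
Let Fin (v : V) c : int := if inside v then F (coords v) c else (v c)%:Z.
Let id_ (v : V) c : int := (v c)%:Z.
Let term (H : V -> 'I_n.+1 -> int) s y :=
  (-1) ^+ (odd_perm s) * \det (diff_mx (fun j => H (kuhn_vertex e s y j))).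
Let core (y : V) := [forall c, (0 < y c <= K)%N].
Let layer (y : V) :=
  [exists c, [|| y c == 0%N :> nat, y c == K.+1 :> nat | y c == K.+2 :> nat]].

Let kv_nowrap s (y : V) j : (forall c, (y c <= K.+2)%N) ->
  coords (kuhn_vertex e s y j) = grid_vertex s (coords y) j.
Proof.
move=> yK; apply/funext => c; rewrite /coords kvE /grid_vertex modn_small //.
by rewrite /coords; have := NE; have := yK c; case: (_ < j)%N => /=; lia.
Qed.

Let term_id s (y : V) : (forall c, (y c <= K.+2)%N) -> term id_ s y = 1.
Proof.
move=> yK; rewrite /term.
have -> : diff_mx (fun j => id_ (kuhn_vertex e s y j)) = perm_mx s.
  apply/matrixP => j c; rewrite !mxE /id_.
  have h i : kuhn_vertex e s y i c = grid_vertex s (coords y) i c :> nat.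
    by rewrite -kv_nowrap.
  rewrite !h /grid_vertex !PoszD opprD addrACA subrr add0r eq_sym.
  rewrite -(inj_eq (@perm_inj _ s^-1)) permK.
  rewrite -val_eqE /= ltnS; case: (ltngtP ((s^-1)%g c) j) => //.
by rewrite det_perm -expr2 sqrr_sign.
Qed.

Let term_core s (y : V) : core y -> term Fin s y = 0.
Proof.
move=> /forallP yc.
have yK c : (y c <= K.+2)%N by have := yc c; lia.
have ins (j : nat) : inside (kuhn_vertex e s y j).
  apply/forallP => c; rewrite -[nat_of_ord _]/(coords _ c) kv_nowrap //.
  rewrite /grid_vertex /coords; have := yc c; case: (_ < j)%N; lia.
have [a [b [ab Fab]]] := F_collapse s (coords y).
rewrite /term (@det_diff_mx0 _ _ _ a b) ?mulr0 //.
by apply/funext => c; rewrite /Fin !ins !kv_nowrap // Fab.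
Qed.

(** In direction [c] the vertices have only the coordinates [K+3] and [0], and there [Fin] was set
    equal to [id_]. *)
Let term_wrap s (y : V) c : y c = K.+3 :> nat -> term Fin s y = term id_ s y.
Proof.
move=> yc; congr (_ * \det (diff_mx _)).
apply/funext => j; apply/funext => c'; rewrite /Fin; case: ifP => // /forallP.
move=> /(_ c); rewrite kvE yc; case: (_ < j)%N; rewrite ?addn0 ?addn1 ?modnn //.
by rewrite modn_small //; lia.
Qed.

Let Fin_near v c : `|Fin v c - (v c)%:Z| <= D%:Z.
Proof. by rewrite /Fin; case: ifP => _; [exact: F_near | rewrite subrr]. Qed.

Let term_le s (y : V) : (forall c, (y c <= K.+2)%N) -> term Fin s y <= C%:Z.
Proof.
move=> yK; apply: le_trans (ler_norm _) _; rewrite /term normrM normr_sign mul1r.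
rewrite /C -natz natrM natrX; apply: normr_det_le => j c.
rewrite mxE natz; set u := kuhn_vertex _ _ _ _; set v := kuhn_vertex _ _ _ _.
have hu : u c = grid_vertex s (coords y) j.+1 c :> nat by rewrite -kv_nowrap.
have hv : v c = grid_vertex s (coords y) j c :> nat by rewrite -kv_nowrap.
have := Fin_near u c; have := Fin_near v c; rewrite hu hv /grid_vertex ltnS.
by case: (ltngtP ((s^-1)%g c) j) => _; lia.
Qed.

(** The difference is 0 on wrapping cells. Elsewhere the identity contributes 1, while [Fin]
    contributes 0 on the core, by collapse, and at most [C] on the layer. *)
Let term_bound s (y : V) :
  term Fin s y - term id_ s y <= C%:Z * (layer y)%:R - (core y)%:R.
Proof.
have [/existsP[c /eqP yc]|/existsPn nw] := boolP [exists c, y c == K.+3 :> nat].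
  rewrite (term_wrap _ yc) subrr.
  have -> : core y = false by apply/forallP => /(_ c); rewrite yc; lia.
  by rewrite subr0; case: layer; lia.
have yK c : (y c <= K.+2)%N by have := nw c; have := ltn_ord (y c); have := NE; lia.
rewrite term_id //; have [cy|ncy] := boolP (core y).
  by rewrite term_core //; case: layer; lia.
have -> : layer y = true.
  move: ncy; rewrite negb_forall => /existsP[c yc]; apply/existsP; exists c.
  by have := yK c; lia.
have := term_le s yK; lia.
Qed.

Let card_core : #|[set y | core y]%SET| = (K ^ n.+1)%N.
Proof.
have -> : #|[set y | core y]%SET| =
    #|@ffun_on 'I_n.+1 [set i : 'I_N | (0 < i <= K)%N]%SET|.
  apply: eq_card => y; rewrite inE; apply/forallP/ffun_onP => h c;
  by have := h c; rewrite inE.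
rewrite card_ffun_on card_ord; congr (_ ^ _)%N.
rewrite cardsE cardE -(size_map val) /enum_mem -enumT.
have -> : map val [seq x <- enum 'I_N | x \in (fun i : 'I_N => (0 < i <= K)%N)] =
   [seq x <- iota 0 N | (0 < x <= K)%N].
  by rewrite -val_enum_ord filter_map.
have -> : N = (1 + (K + 3))%N by rewrite NE; lia.
rewrite size_filter !iotaD !count_cat /=.
have -> : count (fun x => 0 < x <= K)%N (iota 1 K) = K.
  rewrite (eq_in_count (a2 := predT)) ?count_predT ?size_iota // => x.
  by rewrite mem_iota /=; lia.
by lia.
Qed.

Let card_layer : (#|[set y | layer y]%SET| <= 3 * n.+1 * N ^ n)%N.
Proof.
pose T (v : nat) := (\bigcup_(c : 'I_n.+1) [set y : V | y c == inord v]%SET)%SET.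
have cT v : (#|T v| <= n.+1 * N ^ n)%N.
  apply: (@leq_trans (\sum_(c : 'I_n.+1) #|[set y : V | y c == inord v]%SET|)).
    rewrite /T; elim/big_rec2: _ => [|c m A _ h]; first by rewrite cards0.
    by apply: leq_trans (leq_card_setU _ _) _; rewrite leq_add2l.
  under eq_bigr do rewrite card_ffun_fixed.
  by rewrite sum_nat_const card_ord.
apply: (@leq_trans #|T 0 :|: T K.+1 :|: T K.+2|).
  apply/subset_leq_card/fintype.subsetP => y; rewrite !inE => /existsP[c].
  have E v : (v < N)%N -> y c == v :> nat -> y \in T v.
    move=> vN /eqP yv; apply/bigcupP; exists c => //.
    by rewrite inE; apply/eqP/val_inj; rewrite /= inordK.
  by case/or3P => /E ->; rewrite ?orbT //; have := NE; lia.
apply: leq_trans (leq_card_setU _ _) _.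
have -> : (3 * n.+1 * N ^ n = n.+1 * N ^ n + n.+1 * N ^ n + n.+1 * N ^ n)%N by lia.
exact: leq_add (leq_trans (leq_card_setU _ _) (leq_add (cT _) (cT _))) (cT _).
Qed.

(** Both determinant sums over the torus vanish by Stokes, so summing [term_bound] compares the
    number of core cells with that of layer cells; the number of orders [s] is a common factor. *)
Lemma core_le_layer :
  (K ^ n.+1 <= (n.+1)`! * (2 * D + 1) ^ n.+1 * (3 * n.+1 * K.+4 ^ n))%N.
Proof.
have eq0 : \sum_(s : 'S_n.+1) \sum_y (term Fin s y - term id_ s y) = 0.
  under eq_bigr do rewrite sumrB.
  by rewrite sumrB !kuhn_sum_det subrr.
have le1 : \sum_(s : 'S_n.+1) \sum_y (term Fin s y - term id_ s y) <=
    \sum_(s : 'S_n.+1) \sum_(y : V) (C%:Z * (layer y)%:R - (core y)%:R).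
  by apply: ler_sum => s _; apply: ler_sum => y _; exact: term_bound.
have sumE (P : pred V) : \sum_(y : V) ((P y)%:R : int) = #|[set y | P y]%SET|%:Z.
  rewrite -sum1_card -natz natr_sum [RHS]big_mkcond /=; apply: eq_bigr => y _.
  by rewrite inE; case: (P y).
move: le1; rewrite eq0 sumr_const card_Sn.
rewrite sumrB -mulr_sumr !sumE card_core.
rewrite pmulrn_lge0 ?fact_gt0 // subr_ge0 -PoszM lez_nat => le2.
by apply: leq_trans le2 _; rewrite leq_mul2l card_layer orbT.
Qed.

End no_small_collapse.

(* Otherwise the determinants would vanish on all cells of a cube of side K
   while summing to about K^(n+1). *)
Lemma no_small_collapse (n D : nat) (F : ('I_n.+1 -> nat) -> 'I_n.+1 -> int) :
  (forall x c, `|F x c - (x c)%:Z| <= D%:Z) ->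
  exists (s : 'S_n.+1) y, forall a b : 'I_n.+2,
    a != b -> F (grid_vertex s y a) <> F (grid_vertex s y b).
Proof.
move=> F_near; apply: contrapT => noF.
have F_collapse s y : exists a b : 'I_n.+2,
    a != b /\ F (grid_vertex s y a) = F (grid_vertex s y b).
  apply: contrapT => h; apply: noF; exists s, y => a b ab Fab.
  by apply: h; exists a, b.
have := core_le_layer F_near F_collapse; set C := (_`! * _)%N => le2.
(* The volume K^(n+1) must exceed a fixed multiple of the boundary size K^n; the summand 4 gives
   [K + 4 <= 2 * K]. *)
pose K := (3 * n.+1 * 2 ^ n * C + 4)%N; have {}le2 := le2 K.
have le3 : (K.+4 ^ n <= 2 ^ n * K ^ n)%N.
  by rewrite -expnMn; case: (n) => // m; rewrite leq_exp2r // /K; lia.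
have : (K ^ n.+1 <= (3 * n.+1 * 2 ^ n * C) * K ^ n)%N.
  apply: leq_trans le2 _.
  apply: (@leq_trans (C * (3 * n.+1 * (2 ^ n * K ^ n)))); last by lia.
  by rewrite !leq_mul2l le3 !orbT.
by rewrite expnS leq_pmul2r ?expn_gt0 /K; lia.
Qed.

(** * Bricks in Euclidean space *)

Section euclidean_bound.
Variables (R : realType) (d : nat).
Implicit Types (u v : 'cV[R]_d) (A : 'M[R]_d) (p : eisom R d).

Lemma cV_norm_le u (r : R) : 0 <= r -> (forall i, `|u i ord0| <= r) -> `|u| <= r.
Proof.
move=> r0 ur; rewrite [leLHS]/Num.norm /= mx_normrE; apply/bigmax_leP; split => //.
by move=> [i j] _ /=; rewrite (ord1 j).
Qed.

Lemma cV_norm_ge u i : `|u i ord0| <= `|u|.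
Proof.
rewrite [leRHS]/Num.norm /= mx_normrE.
exact: (le_bigmax _ (fun ij : 'I_d * 'I_1 => `|u ij.1 ij.2|) (i, ord0)).
Qed.

(* Since `|_| is the sup norm, this says that the Euclidean norm of u is at most r. *)
Definition enorm_le (r : R) u : Prop :=
  forall A, A *m A^T = 1%:M -> `|A *m u| <= r.

Lemma enorm_le_norm r u : enorm_le r u -> `|u| <= r.
Proof. by move=> /(_ 1%:M); rewrite trmx1 mulmx1 mul1mx; exact. Qed.

Lemma enorm_leW r s u : r <= s -> enorm_le r u -> enorm_le s u.
Proof. by move=> rs ur A /ur /le_trans; exact. Qed.

Lemma enorm_le0 r : 0 <= r -> enorm_le r 0.
Proof. by move=> r0 A _; rewrite mulmx0 normr0. Qed.

Lemma enorm_leD r s u v :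
  enorm_le r u -> enorm_le s v -> enorm_le (r + s) (u + v).
Proof.
move=> ur vs A oA; rewrite mulmxDr; apply: le_trans (ler_normD _ _) _.
by rewrite lerD ?ur ?vs.
Qed.

Lemma enorm_le_sub r u v : enorm_le r (u - v) -> enorm_le r (v - u).
Proof. by move=> uv A /uv; rewrite -opprB mulmxN normrN. Qed.

Lemma enorm_le_trans r s t u v w : enorm_le r (u - v) -> enorm_le s (v - w) ->
  r + s <= t -> enorm_le t (u - w).
Proof.
move=> uv vw rst; apply: enorm_leW rst _.
have -> : u - w = (u - v) + (v - w) by rewrite addrA subrK.
exact: enorm_leD.
Qed.

Lemma enorm_leM A r u : A *m A^T = 1%:M -> enorm_le r u -> enorm_le r (A *m u).
Proof.
move=> oA ur B oB; rewrite mulmxA; apply: ur.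
by rewrite trmx_mul mulmxA -(mulmxA B) oA mulmx1.
Qed.

Lemma enorm_leZ (c r : R) u : enorm_le r u -> enorm_le (`|c| * r) (c *: u).
Proof. by move=> ur A oA; rewrite -scalemxAr normrZ ler_wpM2l ?ur. Qed.

Lemma orthogonal_entry_le1 A i j : A *m A^T = 1%:M -> `|A i j| <= 1.
Proof.
move=> /matrixP/(_ i i); rewrite !mxE eqxx /= => A1.
rewrite -(@ler_pXn2r _ 2) ?nnegrE // expr1n real_normK ?num_real //.
rewrite -[leRHS]A1 (bigD1 j) //= mxE -expr2 lerDl sumr_ge0 // => k _.
by rewrite mxE -expr2 sqr_ge0.
Qed.

Lemma norm_enorm_le r u : `|u| <= r -> enorm_le (d%:R * r) u.
Proof.
move=> ur A oA; have r0 : 0 <= r by exact: le_trans (normr_ge0 _) ur.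
apply: cV_norm_le => [|i]; first by rewrite mulr_ge0.
rewrite mxE; apply: le_trans (ler_norm_sum _ _ _) _.
rewrite -[d in d%:R]card_ord mulr_natl -sumr_const; apply: ler_sum => j _.
rewrite normrM -[leRHS]mul1r ler_pM ?orthogonal_entry_le1 //.
exact: le_trans (cV_norm_ge _ _) ur.
Qed.

Lemma eisom_actB p x y : eisom_act p x - eisom_act p y = eisom_linear p *m (x - y).
Proof. by rewrite /eisom_act opprD addrACA subrr addr0 mulmxBr. Qed.

Lemma enorm_le_act p r x y :
  enorm_le r (x - y) -> enorm_le r (eisom_act p x - eisom_act p y).
Proof. by move=> xy; rewrite eisom_actB; apply: enorm_leM xy; exact: eisom_mulmxT. Qed.

Lemma eisom_actK p : cancel (eisom_act p) (eisom_act p^-1%g).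
Proof. by move=> x; rewrite -eisom_actM mulVg eisom_act1. Qed.

Lemma eisom_actVK p : cancel (eisom_act p^-1%g) (eisom_act p).
Proof. by move=> x; rewrite -eisom_actM mulgV eisom_act1. Qed.

End euclidean_bound.

Section rounding.
Variable R : realType.
Implicit Types (t s e : R) (z : int).

Definition round t : int := Num.floor (t + 2^-1).
Definition near_int e t : bool := `|t - (round t)%:~R| <= e.

Lemma round_def t z : `|t - z%:~R| < 2^-1 -> round t = z.
Proof.
rewrite ltr_norml => /andP[h1 h2]; apply: floor_def.
by rewrite intrD; apply/andP; split; lra.
Qed.

Lemma near_int_close e e' eps t s : near_int e' t -> `|t - s| <= eps ->
  e' + eps <= e -> e < 2^-1 -> round s = round t /\ near_int e s.
Proof.
rewrite /near_int => ht hts he he2.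
have hs : `|s - (round t)%:~R| <= e.
  rewrite -(subrK t s) -addrA; apply: le_trans (ler_normD _ _) _.
  by rewrite (distrC s t); lra.
have rs : round s = round t by apply: round_def; apply: le_lt_trans hs he2.
by rewrite rs.
Qed.

(** An integer separating [t] from [s] would lie within [e] of the larger of the two. *)
Lemma floor_close e t s : ~~ near_int e t -> ~~ near_int e s ->
  `|t - s| <= e -> e < 2^-1 -> Num.floor t = Num.floor s.
Proof.
wlog ts : t s / Num.floor t < Num.floor s => [W nt ns hts he|].
  case: (ltgtP (Num.floor t) (Num.floor s)) => // h; first exact: W.
  by apply/esym; apply: W => //; rewrite distrC.
move=> _ /negP ns hts he; exfalso; apply: ns.
have h1 : t < (Num.floor s)%:~R.
  apply: lt_le_trans (floorD1_gt _) _; rewrite ?num_real //.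
  by rewrite ler_int -ltzD1 ltrD2r.
have h2 : (Num.floor s)%:~R <= s by exact: floor_le_tmp.
have hs : `|s - (Num.floor s)%:~R| <= e.
  by move: hts; rewrite !ler_norml; lra.
rewrite /near_int; suff -> : round s = Num.floor s by [].
by apply: round_def; lra.
Qed.

Lemma floor_eq_close t s : Num.floor t = Num.floor s -> `|t - s| <= 1.
Proof.
move=> e; have := floor_itv t; have := floor_itv s; rewrite e ler_norml intrD.
by move=> /andP[? ?] /andP[? ?]; lra.
Qed.

Lemma round_eq_close t s : round t = round s -> `|t - s| <= 1.
Proof.
by move=> /floor_eq_close; rewrite opprD addrACA subrr addr0.
Qed.

End rounding.

Section separated_cover.
Variables (R : realType) (d : nat).
Implicit Types (X : set 'cV[R]_d) (S : groupClosed (eisom R d)).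

(* X is covered by d + 1 sets W i; the classes of E i are the pieces of W i,
   they have diameter at most D and are eps-separated. *)
Definition separated_cover X (eps D : R) (W : 'I_d.+1 -> set 'cV[R]_d)
    (E : 'I_d.+1 -> 'cV[R]_d -> 'cV[R]_d -> Prop) : Prop :=
  [/\ X `<=` \bigcup_i W i,
      forall i x y, E i x y -> E i y x,
      forall i x y z, E i x y -> E i y z -> E i x z,
      forall i x y, W i x -> W i y -> enorm_le eps (x - y) -> E i x y &
      forall i x y, E i x y -> W i x /\ enorm_le D (x - y)].

Definition invariant_cover S (W : 'I_d.+1 -> set 'cV[R]_d) : Prop :=
  forall i p x, p \in S -> W i x -> W i (eisom_act p x).

(** With this value the thresholds [theta k] decrease from 1/4 by steps of [eps], and the last one
    used, at k = d + 1, is still [eps]. *)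
Let eps : R := (4 * d.+2%:R)^-1.
Let theta k : R := (d.+2 - k)%:R * eps.
Let J (e : R) (x : 'cV[R]_d) := [set j | near_int e (x j ord0)]%SET.
(* C k consists of the points close to the k-skeleton of the unit cubes, but not
   too close to the (k-1)-skeleton. *)
Let C k x := ((d - k <= #|J (theta k.+1) x|) && (#|J (theta k) x| <= d - k))%N.
(** Names the brick of [x]: coordinates close to an integer are rounded, the others floored, and the
    boolean keeps the two cases apart. *)
Let key (k : nat) (x : 'cV[R]_d) j : int * bool :=
  if j \in J (theta k.+1) x then (round (x j ord0), true)
  else (Num.floor (x j ord0), false).

Let eps_gt0 : 0 < eps. Proof. by rewrite invr_gt0 mulr_gt0. Qed.

Let theta_step k : (k <= d)%N -> theta k.+1 + eps = theta k.
Proof.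
move=> kd; rewrite /theta -{2}[eps]mul1r -mulrDl natr1.
by congr (_%:R * _); lia.
Qed.

Let theta_lt k : theta k < 2^-1.
Proof.
apply: (@le_lt_trans _ _ (d.+2%:R * eps)); first by rewrite ler_pM2r // ler_nat leq_subr.
by rewrite /eps invfM mulrCA divff ?pnatr_eq0 // mulr1; lra.
Qed.

Let eps_theta k : (k <= d)%N -> eps <= theta k.+1.
Proof.
by move=> kd; rewrite /theta -{1}[eps]mul1r ler_pM2r // ler1n; lia.
Qed.

(** The larger threshold admits more coordinates, and the two cardinality bounds in [C] squeeze the
    sets together. *)
Let J_eq (k : 'I_d.+1) x : C k x -> J (theta k.+1) x = J (theta k) x.
Proof.
move=> /andP[h1 h2]; apply/eqP; rewrite eqEcard (leq_trans h2 h1) andbT.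
apply/fintype.subsetP => j; rewrite !inE => /le_trans; apply.
by rewrite -(@theta_step k) ?lerDl ?ltW // -ltnS.
Qed.

(** Moving by [eps] passes from threshold [theta k.+1] to [theta k], which by [J_eq] makes no
    difference at [y]. *)
Let J_sub (k : 'I_d.+1) x y : C k y -> `|x - y| <= eps ->
  {subset J (theta k.+1) x <= J (theta k.+1) y}.
Proof.
move=> Cy xy j; rewrite (J_eq Cy) !inE => xj.
apply: (proj2 (near_int_close xj (le_trans _ xy) _ (theta_lt k))).
  by have := cV_norm_ge (x - y) j; rewrite !mxE.
by rewrite theta_step // -ltnS.
Qed.

Let key_close (k : 'I_d.+1) x y : C k x -> C k y -> `|x - y| <= eps ->
  key k x = key k y.
Proof.
move=> Cx Cy xy; have kd : (k <= d)%N by rewrite -ltnS.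
have JE : J (theta k.+1) x =i J (theta k.+1) y.
  by move=> j; apply/idP/idP; apply: J_sub => //; rewrite distrC.
apply/funext => j; rewrite /key JE.
have xyj : `|x j ord0 - y j ord0| <= eps.
  by apply: le_trans xy; have := cV_norm_ge (x - y) j; rewrite !mxE.
case: ifPn => jy.
  have := jy; rewrite -JE inE => jx; congr (_, _); apply/esym.
  by have [] := near_int_close jx xyj _ (theta_lt k); rewrite ?theta_step.
congr (_, _); apply: (floor_close (e := theta k.+1)) => //.
- by have := jy; rewrite -JE inE.
- by have := jy; rewrite inE.
- exact: le_trans xyj (eps_theta kd).
Qed.

Let C_cover x : exists k : 'I_d.+1, C k x.
Proof.
have exk : exists k, (d - k <= #|J (theta k.+1) x|)%N by exists d; rewrite subnn.
(* The least [k] with the first inequality of [C]; its failure at k - 1 is the second one. *)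
have [k hk kmin] := ex_minnP exk.
have kd : (k < d.+1)%N by rewrite ltnS; apply: kmin; rewrite subnn.
exists (Ordinal kd); rewrite /C hk /=.
case: k {hk} kmin kd => [|k] kmin kd.
  by rewrite subn0 -[leqRHS]card_ord max_card.
have : ~~ (d - k <= #|J (theta k.+1) x|)%N by apply/negP => /kmin; rewrite ltnn.
by rewrite -ltnNge => lt_J; rewrite subnS -ltnS (ltn_predK lt_J).
Qed.

Lemma brick_cover : exists2 eps : R, 0 < eps &
  exists W E, separated_cover setT eps d%:R W E.
Proof.
exists eps => //; exists (fun k => [set x | C k x]).
exists (fun k x y => [/\ C k x, C k y & key k x = key k y]); split.
- by move=> x _; have [k kx] := C_cover x; exists k.
- by move=> k x y [].
- by move=> k x y z [Cx _ ->] [].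
- move=> k x y Cx Cy /enorm_le_norm xy; split => //; exact: key_close.
- move=> k x y [Cx Cy kxy]; split=> //; rewrite -[d%:R]mulr1.
  apply: norm_enorm_le; apply: cV_norm_le => // j; rewrite !mxE.
  have := congr1 (fun f => f j) kxy; rewrite /key.
  by case: ifP => _; case: ifP => // _ [];
    [exact: round_eq_close | exact: floor_eq_close].
Qed.

End separated_cover.

(** * Gluing separated covers *)

Section cover_construction.
Variables (R : realType) (d : nat) (S : groupClosed (eisom R d)).
Local Notation V := ('cV[R]_d).

Lemma separated_coverW X (eps eps' D : R) W E : eps' <= eps ->
  @separated_cover R d X eps D W E -> separated_cover X eps' D W E.
Proof.
move=> le_eps [h1 h2 h3 h4 h5]; split => // i x y Wx Wy xy.
by apply: h4 => //; exact: enorm_leW xy.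
Qed.

Section union.
Variables (X X' : set V) (eps D eps' D' : R).
Variables (W W' : 'I_d.+1 -> set V) (E E' : 'I_d.+1 -> V -> V -> Prop).
Hypotheses (D'0 : 0 <= D') (eps'0 : 0 <= eps') (D0 : 0 <= D).
Hypothesis coarse : separated_cover X eps D W E.
Hypothesis fine : separated_cover X' eps' D' W' E'.
Hypothesis fine_coarse : D' + 2 * eps' <= eps.

(** [attached]: the fine piece of [x] comes within [eps'] of the coarse point [b]. In [EU] such fine
    pieces join the coarse piece of [b]. *)
Let attached i x b := x = b \/ exists2 a, E' i x a & enorm_le eps' (a - b).
Let EU i x y := E' i x y \/
  exists b b', [/\ attached i x b, E i b b' & attached i y b'].

Let refl i x : W i x -> E i x x.
Proof.
case: coarse => _ _ _ h _ Wx; apply: h => //; rewrite subrr; apply: enorm_le0.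
by have := D'0; have := eps'0; have := fine_coarse; lra.
Qed.

Let attached_refl' i x b : W' i x -> enorm_le eps' (x - b) -> attached i x b.
Proof.
case: fine => _ _ _ h _ Wx xb; right; exists x => //.
by apply: h => //; rewrite subrr; exact: enorm_le0.
Qed.

Let attached_dist i x b : attached i x b -> enorm_le (D' + eps') (x - b).
Proof.
case: fine => _ _ _ _ h [->|[a xa ab]].
  by rewrite subrr; apply: enorm_le0; rewrite addr_ge0.
exact: enorm_le_trans (proj2 (h _ _ _ xa)) ab _.
Qed.

(** Coarse points near a common fine piece are at most [D' + 2 * eps'] apart, which is below the
    coarse separation [eps]. So absorbing a fine piece never merges two coarse ones. *)
Let attached_E i x b b' : W i b -> W i b' -> attached i x b -> attached i x b' ->
  E i b b'.
Proof.
case: coarse fine => _ symE trE hE _ [_ symE' trE' _ hE'] Wb Wb'.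
have half c a : W i a -> W i c -> attached i a c -> E i a c.
  move=> Wa Wc /attached_dist ac; apply: hE => //; apply: enorm_leW ac.
  by have := eps'0; have := fine_coarse; lra.
move=> [xb|[a xa ab]] [xb'|[a' xa' ab']]; try subst b; try subst b'.
- exact: refl Wb.
- by apply: half => //; right; exists a'.
- by apply: symE; apply: half => //; right; exists a.
- apply: hE => //; apply: (enorm_le_trans (enorm_le_sub ab) (s := D' + eps')).
    apply: (enorm_le_trans _ ab' (lexx _)).
    by apply: (proj2 (hE' i _ _ _)); exact: trE' (symE' _ _ _ xa) xa'.
  by have := fine_coarse; lra.
Qed.

Let attached_E' i x y b : W i b -> E' i x y -> attached i x b -> attached i y b.
Proof.
case: fine => _ symE' trE' hE' hE Wb xy [xb|[a xa ab]].
  right; exists b; last by rewrite subrr; exact: enorm_le0.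
  by rewrite -xb; exact: symE'.
by right; exists a => //; exact: trE' (symE' _ _ _ xy) xa.
Qed.

(** The fine pieces attached to a coarse piece add at most [D' + eps'] to it at either end, whence
    the new diameter bound. *)
Lemma separated_cover_union :
  separated_cover (X `|` X') eps' (D + 2 * (D' + eps'))
    (fun i => W i `|` W' i) EU.
Proof.
have [cX symE trE hE dE] := coarse; have [cX' symE' trE' hE' dE'] := fine.
have WE i b b' : E i b b' -> W i b /\ W i b'.
  by move=> bb'; split; [case: (dE _ _ _ bb') | case: (dE _ _ _ (symE _ _ _ bb'))].
have Watt i x b : W i b -> attached i x b -> W i x \/ W' i x.
  by move=> Wb [->|[a /dE'[]]]; [left | right].
split.
- by move=> x [/cX|/cX'] [i _ ?]; exists i => //; [left | right].
- move=> i x y [/symE'|[b [b' [xb bb' yb']]]]; first by left.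
  by right; exists b', b; split => //; exact: symE.
- move=> i x y z [xy|[b [b' [xb bb' yb']]]] [yz|[c [c' [yc cc' zc']]]].
  + by left; exact: trE' xy yz.
  + right; exists c, c'; split => //; have [Wc _] := WE _ _ _ cc'.
    exact: attached_E' Wc (symE' _ _ _ xy) yc.
  + right; exists b, b'; split => //; have [_ Wb'] := WE _ _ _ bb'.
    exact: attached_E' Wb' yz yb'.
  + right; exists b, c'; split => //.
    have [_ Wb'] := WE _ _ _ bb'; have [Wc _] := WE _ _ _ cc'.
    exact: trE bb' (trE _ _ _ _ (attached_E Wb' Wc yb' yc) cc').
- move=> i x y [Wx|W'x] [Wy|W'y] xy.
  + right; exists x, y; split; [by left| |by left]; apply: hE => //.
    by apply: enorm_leW xy; have := D'0; have := eps'0; have := fine_coarse; lra.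
  + right; exists x, x; split; [by left | exact: refl |].
    by apply: attached_refl' => //; exact: enorm_le_sub.
  + by right; exists y, y; split; [exact: attached_refl' | exact: refl | left].
  + by left; exact: hE'.
- move=> i x y [xy|[b [b' [xb bb' yb']]]].
    have [W'x dxy] := dE' _ _ _ xy; split; first by right.
    by apply: enorm_leW dxy; have := D0; have := D'0; have := eps'0; lra.
  have [Wb dbb'] := dE _ _ _ bb'; split; first exact: Watt xb.
  apply: (enorm_le_trans (attached_dist xb) (s := D + (D' + eps'))); last by lra.
  exact: (enorm_le_trans dbb' (enorm_le_sub (attached_dist yb')) (lexx _)).
Qed.

Lemma invariant_cover_union : invariant_cover S W -> invariant_cover S W' ->
  invariant_cover S (fun i => W i `|` W' i).
Proof.
by move=> iW iW' i p x Sp [?|?]; [left; exact: iW | right; exact: iW'].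
Qed.

End union.

Section local.
Variables (x0 : V) (rho : R).
Hypothesis rho0 : 0 < rho.
Hypothesis small : forall p y, p \in S -> `|y - x0| <= 2 * rho ->
  `|eisom_act p y - x0| <= 2 * rho -> p = 1%g.

(** The translates of the small ball are disjoint, so a rescaled brick cover of the ball can be
    copied to all of them by the group, which makes it invariant. *)
Lemma local_cover (delta : R) : 0 < delta ->
  exists2 eps, 0 < eps & exists W E,
    separated_cover [set x | exists2 p, p \in S & `|eisom_act p x - x0| <= rho]
      eps delta W E /\ invariant_cover S W.
Proof.
move=> delta0; have [eps0 eps00 [W0 [E0 [cov0 sym0 tr0 sep0 diam0]]]] := brick_cover R d.
(* Bricks have diameter at most [d], so after scaling by [c] at most [delta]; [d.+1] avoids dividing
   by zero. *)
pose c := delta / d.+1%:R; have c0 : 0 < c by rewrite divr_gt0.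
pose B (b : V) := `|b - x0| <= rho.
(* Distinct translates of the ball are more than [rho] apart; this is why [small] is stated with
   radius [2 * rho]. *)
have cancel_act p q (x y : V) : p \in S -> q \in S -> B y ->
    enorm_le rho (eisom_act p x - eisom_act q y) -> B x -> p = q.
  move=> Sp Sq By xy Bx; have : (p^-1 * q)%g = 1%g.
    apply: (small (y := y)); first by rewrite gpredM ?gpredV.
      by move: By; rewrite /B => By; have := rho0; lra.
    have /enorm_le_norm := enorm_le_act p^-1%g xy.
    rewrite eisom_actK -eisom_actM distrC => h.
    have -> : eisom_act (p^-1 * q)%g y - x0 =
       (eisom_act (p^-1 * q)%g y - x) + (x - x0) by rewrite addrA subrK.
    by apply: le_trans (ler_normD _ _) _; move: Bx; rewrite /B; lra.
  by move/(congr1 (fun g => p * g)%g); rewrite mulKVg mulg1.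
exists (Num.min rho (c * eps0)); first by rewrite lt_min rho0 mulr_gt0.
pose W i := [set x | exists p b, [/\ p \in S, x = eisom_act p b, B b & W0 i (c^-1 *: b)]].
pose E i x y := exists p b b', [/\ p \in S, x = eisom_act p b, y = eisom_act p b',
   B b /\ B b' & E0 i (c^-1 *: b) (c^-1 *: b')].
exists W, E; split; first split.
- move=> x [p Sp px]; have [i _ Wi] := cov0 (c^-1 *: eisom_act p x) I.
  exists i => //; exists p^-1%g, (eisom_act p x); split => //.
    by rewrite gpredV.
  by rewrite eisom_actK.
- move=> i x y [p [b [b' [Sp -> -> [Bb Bb'] bb']]]]; exists p, b', b; split => //.
  exact: sym0.
- move=> i x y z [p [b [b' [Sp -> -> [Bb Bb'] bb']]]].
  move=> [q [e [e' [Sq pb -> [Be Be'] ee']]]].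
  have pq : p = q.
    by apply: (cancel_act p q b' e) => //; rewrite pb subrr; apply: enorm_le0; exact: ltW.
  move: pb; rewrite -pq => /(can_inj (eisom_actK p)) be.
  exists p, b, e'; split => //; apply: tr0 bb' _; by rewrite be.
- move=> i x y [p [b [Sp -> Bb Wb]]] [q [b' [Sq -> Bb' Wb']]] bb'.
  have pq : p = q.
    apply: (cancel_act p q b b') => //; apply: enorm_leW bb'.
    by rewrite ge_min lexx.
  move: bb'; rewrite -pq => bb'; exists p, b, b'; split => //; apply: sep0 => //.
  rewrite -scalerBr; have := enorm_le_act p^-1%g bb'; rewrite !eisom_actK => {}bb'.
  have := enorm_leZ c^-1 bb'; apply: enorm_leW.
  rewrite gtr0_norm ?invr_gt0 // ler_pdivrMl //.
  by rewrite ge_min lexx orbT.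
- move=> i x y [p [b [b' [Sp -> -> [Bb Bb'] bb']]]].
  have [Wb /(enorm_leZ c)] := diam0 _ _ _ bb'; rewrite -scalerBr scalerA.
  rewrite divff ?gt_eqF // scale1r => dbb'; split; first by exists p, b.
  apply: enorm_le_act; apply: enorm_leW dbb'; rewrite gtr0_norm // /c.
  rewrite -mulrA ler_piMr ?(ltW delta0) // ler_pdivrMl // mulr1 ler_nat //.
- move=> i p x Sp [q [b [Sq -> Bb Wb]]]; exists (p * q)%g, b; split => //.
    by rewrite gpredM.
  by rewrite eisom_actM.
Qed.

End local.

Lemma finite_union_cover (rho : V -> R) (s : seq V) :
  (forall x, 0 < rho x) ->
  (forall x p y, p \in S -> `|y - x| <= 2 * rho x ->
     `|eisom_act p y - x| <= 2 * rho x -> p = 1%g) ->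
  exists eps D : R, [/\ 0 < eps, 0 <= D & exists W E,
    separated_cover
      [set x | exists2 c, c \in s & exists2 p, p \in S & `|eisom_act p x - c| <= rho c]
      eps D W E /\ invariant_cover S W].
Proof.
move=> rho0 small; elim: s => [|c s [eps [D [eps0 D0 [W [E [cov inv]]]]]]].
  exists 1, 0; split => //; exists (fun=> set0), (fun _ _ _ => False).
  by split=> //; split => //; move=> x [].
(* Pieces around the new ball of size [eps / 3] with separation at most [eps / 3] meet the gluing
   condition [D' + 2 * eps' <= eps]. *)
have delta0 : 0 < eps / 3 by rewrite divr_gt0.
have [eps' eps'0 [W' [E' [cov' inv']]]] :=
  local_cover (rho0 c) (small c) delta0.
pose e' := Num.min eps' (eps / 3).
have e'0 : 0 < e' by rewrite lt_min eps'0.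
have le_e' : e' <= eps / 3 by rewrite ge_min lexx orbT.
have {}cov' : separated_cover
    [set x | exists2 p, p \in S & `|eisom_act p x - c| <= rho c] e' (eps / 3) W' E'.
  by apply: separated_coverW cov'; rewrite ge_min lexx.
exists e', (D + 2 * (eps / 3 + e')); split => //; first by lra.

have ce : eps / 3 + 2 * e' <= eps by lra.
have [h1 h2 h3 h4 h5] := separated_cover_union (ltW delta0) (ltW e'0) D0 cov cov' ce.
eexists; eexists; split; last exact: (invariant_cover_union inv inv').
split; [|exact: h2|exact: h3|exact: h4|exact: h5].
move=> x [c']; rewrite inE => /orP[/eqP->|c's] h; apply: h1; first by right.
by left; exists c'.
Qed.

End cover_construction.

(** * Crystallographic groups *)

Section crystallographic_geometry.
Variables (R : realType) (d : nat).
Local Notation V := ('cV[R]_d).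

Lemma trmx_continuous m n : continuous (@trmx R m n).
Proof.
move=> M s /= /(nbhs_ballP (M^T)) [e e0 es].
apply/nbhs_ballP; exists e => //= N [_ MN]; apply: es; split => // i j.
by rewrite !mxE; exact: MN.
Qed.

(** Heine-Borel for row vectors, carried over by transposition. *)
Lemma compact_cV_ball (c : V) (r : R) : compact [set x : V | `|x - c| <= r].
Proof.
have trN m n (M : 'M[R]_(m, n)) : `|M^T| <= `|M|.
  rewrite [leLHS]/Num.norm /= mx_normrE; apply/bigmax_leP; split => // -[i j] _ /=.
  rewrite mxE [leRHS]/Num.norm /= mx_normrE.
  exact: (le_bigmax _ (fun ij : 'I_m * 'I_n => `|M ij.1 ij.2|) (j, i)).
have -> : [set x : V | `|x - c| <= r] = trmx @` (closed_ball_ Num.norm c^T r).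
  apply/seteqP; split => [x xr|_ [y yr <-]].
    exists x^T; last exact: trmxK.
    by rewrite /closed_ball_ /= distrC -raddfB /=; exact: le_trans (trN _ _ _) xr.
  rewrite /= -[c]trmxK -raddfB /=; apply: le_trans (trN _ _ _) _.
  by rewrite distrC.
apply: continuous_compact; first by apply: continuous_subspaceT; exact: trmx_continuous.
apply: bounded_closed_compact; last exact: closed_closed_ball_.
exists (`|c^T| + r); split; first exact: num_real.
move=> M ltM x; rewrite /closed_ball_ /= distrC => xr.
rewrite -(subrK c^T x); apply: le_trans (ler_normD _ _) _.
by lra.
Qed.

Lemma eisom_act_continuous (p : eisom R d) : continuous (eisom_act p).
Proof.
move=> x s /= /(nbhs_ballP (eisom_act p x)) [e e0 es].
apply/nbhs_ballP; exists (e / d.+1%:R); first by rewrite /= divr_gt0.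
move=> y /=; rewrite -ball_normE /= => xy; apply: es; rewrite -ball_normE /=.
have /(enorm_le_act p)/enorm_le_norm h := norm_enorm_le (ltW xy).
apply: le_lt_trans h _; rewrite mulrCA gtr_pMr //.
by rewrite ltr_pdivrMr // mul1r ltr_nat.
Qed.

Lemma finite_pos_lb (T : choiceType) (A : set T) (f : T -> R) : finite_set A ->
  (forall x, A x -> 0 < f x) -> exists2 e, 0 < e & forall x, A x -> e <= f x.
Proof.
move=> /finite_seqP[s ->]; elim: s => [|a s IH] fpos; first by exists 1.
have [|e e0 es] := IH; first by move=> x xs; apply: fpos; rewrite /= inE xs orbT.
exists (Num.min e (f a)); first by rewrite lt_min e0 fpos //= inE eqxx.
move=> x /=; rewrite inE => /orP[/eqP->|/es]; rewrite ge_min ?lexx ?orbT //.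
by move=> ->.
Qed.

Section flat_manifold.
Variable Y : flat_manifold R d.
Local Notation S := (deck Y).

Lemma deck_ball_finite (c : V) (r : R) :
  finite_set [set p : eisom R d | p \in S /\
    exists2 y : V, `|y - c| <= r & `|eisom_act p y - c| <= r].
Proof.
apply: sub_finite_set (deck_proper Y (@compact_cV_ball c r)) => p [Sp [y yr pyr]].
by split => //; exists (eisom_act p y); split => //; exists y.
Qed.

(** By properness only finitely many elements return the unit ball to itself, and by freeness the
    nontrivial ones move [x] by at least some [e > 0]. An element returning the ball of radius
    [2 * rho] moves [x] by at most [(d + 1) * (2 * rho) <= e / 2]. *)
Lemma deck_small_ball (x : V) : exists2 rho : R, 0 < rho &
  forall p y, p \in S -> `|y - x| <= 2 * rho ->
    `|eisom_act p y - x| <= 2 * rho -> p = 1%g.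
Proof.
set P := [set p : eisom R d | p \in S /\
    exists2 y : V, `|y - x| <= 1 & `|eisom_act p y - x| <= 1].
have finP : finite_set (P `&` [set p | p <> 1%g]).
  by apply: sub_finite_set (deck_ball_finite x 1) => p [].
have [|e e0 eP] := finite_pos_lb (f := fun p => `|eisom_act p x - x|) finP.
  move=> p [[Sp _] p1]; rewrite normr_gt0 subr_eq0; apply/eqP => px.
  by apply: p1; exact: deck_free Sp px.
pose rho := Num.min 2^-1 (e / (4 * d.+1%:R)).
have rho0 : 0 < rho by rewrite lt_min invr_gt0 ltr0n divr_gt0 // mulr_gt0.
exists rho => // p y Sp yx pyx.
have le1 : 2 * rho <= 1 by rewrite -ler_pdivlMl // mulr1 ge_min lexx.
apply: contrapT => p1.
have /eP : (P `&` [set p | p <> 1%g]) p.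
  by split => //; split => //; exists y; [exact: le_trans yx le1|exact: le_trans pyx le1].
apply/negP; rewrite -ltNge.
have /(enorm_le_act p)/enorm_le_norm h := norm_enorm_le yx.
have -> : eisom_act p x - x = (eisom_act p y - x) - (eisom_act p y - eisom_act p x).
  by rewrite opprB [RHS]addrC addrA subrK.
apply: le_lt_trans (ler_normB _ _) _; apply: le_lt_trans (lerD pyx h) _.
rewrite -{1}[2 * rho]mul1r -mulrDl addrC natr1.
apply: (@le_lt_trans _ _ (d.+1%:R * (2 * (e / (4 * d.+1%:R))))).
  by rewrite ler_pM2l // ler_pM2l // ge_min lexx orbT.
have -> : d.+1%:R * (2 * (e / (4 * d.+1%:R))) = e / 2 :> R.
  by field; rewrite addrC natr1 pnatr_eq0.
by rewrite ltr_pdivrMr // ltr_pMr // ltr1n.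
Qed.

Lemma fm_projE (x y : V) : fm_proj Y x = fm_proj Y y ->
  exists2 p, p \in S & y = eisom_act p x.
Proof. by move=> /eqquotP /asboolP. Qed.

Lemma fm_proj_act p (x : V) : p \in S -> fm_proj Y (eisom_act p x) = fm_proj Y x.
Proof.
move=> Sp; apply/esym/eqquotP/asboolP; by exists p.
Qed.

Lemma fm_proj_open (A : set V) : open A -> open (fm_proj Y @` A).
Proof.
move=> oA; rewrite /open /= /quotient_open.
rewrite (_ : _ @^-1` _ = \bigcup_(p in [set` S]) (eisom_act p @^-1` A)).
  apply: bigcup_open => p _; apply: open_comp => // x _; exact: eisom_act_continuous.
apply/seteqP; split => [x [a Aa ax]|x [p Sp Apx]].
  by have [p Sp ap] := fm_projE (esym ax); exists p => //=; rewrite -ap.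
by exists (eisom_act p x) => //; exact: fm_proj_act.
Qed.

(** The images of the balls of radius [n] around [c] exhaust the compact quotient, so one of them is
    everything. *)
Lemma deck_cobounded (c : V) : exists r : R,
  forall x, exists2 p, p \in S & `|eisom_act p x - c| <= r.
Proof.
pose P (n : nat) (z : fm_space Y) := exists2 x, fm_proj Y x = z & `|x - c| <= n%:R.
have cover : \forall n \near \oo, [set: fm_space Y] `<=` P n.
  have := @deck_cocompact _ _ Y => /compact_near_coveringP; apply => z _.
  have [x xz] : exists x, fm_proj Y x = z.
    by exists (generic_quotient.repr z); rewrite /fm_proj /orbit_proj reprK.
  exists (fm_proj Y @` ball x 1, [set n : nat | `|x - c| + 1 <= n%:R]).
    split => /=; last first.
      near=> n; near: n; exact: nbhs_infty_ger.
    have oz : open_nbhs (z : fm_space Y) (fm_proj Y @` ball x 1).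
      split; last by exists x => //; exact: ballxx.
      by apply: fm_proj_open; exact: ball_open.
    exact: open_nbhs_nbhs oz.
  move=> [z' n] /= [[y xy yz'] xn]; exists y => //.
  move: xy; rewrite -ball_normE /= distrC => xy.
  have -> : y - c = (y - x) + (x - c) by rewrite addrA subrK.
  by apply: le_trans (ler_normD _ _) _; lra.
have [n nP] : exists n, [set: fm_space Y] `<=` P n.
  exact: filter_ex cover.
exists n%:R => x; have [y /fm_projE[p Sp yx] yn] := nP (fm_proj Y x) I.
exists p^-1%g; first by rewrite gpredV.
by rewrite yx eisom_actK.
Unshelve. all: by end_near. Qed.

(** Some closed ball meets every orbit, and finitely many of the small balls cover it; their
    invariant covers are glued. *)
Lemma invariant_separated_cover : exists eps D : R,
  [/\ 0 < eps, 0 <= D & exists W E,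
    separated_cover [set: V] eps D W E /\ invariant_cover S W].
Proof.
pose rho x := s2val (cid2 (deck_small_ball x)).
have rho0 x : 0 < rho x by rewrite /rho; case: cid2.
have small x p y : p \in S -> `|y - x| <= 2 * rho x ->
    `|eisom_act p y - x| <= 2 * rho x -> p = 1%g.
  by rewrite /rho; case: cid2 => r r0 /= h; exact: h.
have [r hr] := deck_cobounded 0.
have /(_ _ [set: V] (fun x => ball x (rho x))) [||s _ scov] :
    @cover_compact V [set x : V | `|x - 0| <= r].
- by rewrite -compact_cover; exact: compact_cV_ball.
- by move=> x _; exact: ball_open.
- by move=> x _; exists x => //; exact: ballxx.
have [eps [D [eps0 D0 [W [E [cov inv]]]]]] :=
  finite_union_cover (S := S) (finmap.enum_fset s) rho0 small.
exists eps, D; split => //; exists W, E; split => //.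
case: cov => h1 h2 h3 h4 h5; split => // x _; apply: h1.
have [p Sp /scov [c cs]] := hr x; rewrite -ball_normE /= distrC => /ltW cx.
by exists c => //; exists p.
Qed.

End flat_manifold.
End crystallographic_geometry.

(** * Lifts of the expanding self-cover and their inverses *)

Section expanding_lift.
Variables (R : realType) (d : nat) (Y : flat_manifold R d) (lam : R).
Variable gl : 'cV[R]_d -> 'cV[R]_d.
Hypothesis gl_continuous : continuous gl.
Hypothesis gl_proj : forall x, fm_proj Y (gl x) = fm_proj Y (lam *: x).
Local Notation S := (deck Y).

(** Nearby, [g^-1 gl] and the homothety take values in one small ball and in one orbit, and such a
    ball meets an orbit at most once. *)
Let gl_locally (g : eisom R d) x t0 : g \in S ->
  gl (t0 *: x) = eisom_act g (lam *: (t0 *: x)) ->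
  \forall t \near t0, gl (t *: x) = eisom_act g (lam *: (t *: x)).
Proof.
move=> Sg gt0; set z := lam *: (t0 *: x).
have [rho rho0 small] := deck_small_ball Y z.
have cx := @scalel_continuous R 'cV[R]_d x t0.
have c1 : (fun t : R => lam *: (t *: x)) @ t0 --> z.
  exact: (continuous_comp cx (@scaler_continuous R 'cV[R]_d lam _)).
have c2 : (fun t : R => eisom_act g^-1%g (gl (t *: x))) @ t0 --> z.
  have -> : z = eisom_act g^-1%g (gl (t0 *: x)) by rewrite gt0 eisom_actK.
  exact: (continuous_comp (continuous_comp cx (@gl_continuous _))
    (@eisom_act_continuous _ _ g^-1%g _)).
have B0 : nbhs z [set y | `|y - z| <= 2 * rho].
  apply/nbhs_ballP; exists (2 * rho) => /=; first by rewrite mulr_gt0.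
  by move=> y; rewrite -ball_normE /= distrC => /ltW.
have {}c1 : \forall t \near t0, `|lam *: (t *: x) - z| <= 2 * rho := c1 _ B0.
have {}c2 : \forall t \near t0, `|eisom_act g^-1%g (gl (t *: x)) - z| <= 2 * rho := c2 _ B0.
apply: filterS2 c2 c1 => t h2 h1.
have [p Sp glp] := fm_projE (esym (gl_proj (t *: x))).
have p1 : (g^-1 * p)%g = 1%g.
  apply: (small _ (lam *: (t *: x))); first by rewrite gpredM ?gpredV.
    exact: h1.
  by rewrite eisom_actM -glp; exact: h2.
rewrite glp; congr (eisom_act _ _).
by move/(congr1 (fun h => g * h)%g): p1; rewrite mulKVg mulg1.
Qed.

(** [gl] and the homothety by [lam] lift the same map. Along the line through 0 and [x], the times
    where [g] relates them form an open set; freeness makes it closed, and it contains 0. *)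
Lemma lift_affine : exists2 g : eisom R d, g \in S &
  forall x, gl x = eisom_act g (lam *: x).
Proof.
have [g Sg g0] := fm_projE (esym (gl_proj 0)).
exists g => // x.
pose A := [set t : R | gl (t *: x) = eisom_act g (lam *: (t *: x))].
have oA : open A by rewrite openE => t At; exact: gl_locally.
have oAc : open (~` A).
  rewrite openE => t At; have [p Sp glp] := fm_projE (esym (gl_proj (t *: x))).
  have := gl_locally Sp glp; apply: filterS => s sp As.
  have pg : p = g.
    apply/eqP; rewrite -[_ == _](inj_eq (mulgI g^-1%g)) mulVg; apply/eqP.
    apply: (@deck_free _ _ Y _ (lam *: (s *: x))).
      by rewrite gpredM ?gpredV.
    by rewrite eisom_actM -sp As eisom_actK.
  by apply: At; rewrite /A /= glp pg.
have connR : connected [set: R] by apply/connected_intervalP => ? ? ? ? ? ?.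
have AT : A = setT.
  apply: connR; first by exists 0; rewrite /A /= scale0r.
    by exists A => //; rewrite setTI.
  by exists A; rewrite ?setTI //; rewrite -[A]setCK; exact: open_closedC.
have : A 1 by rewrite AT.
by rewrite /A /= scale1r.
Qed.

End expanding_lift.

Section expanding_endomorphism.
Variables (R : realType) (d : nat) (Y : flat_manifold R d) (lam : R).
Hypothesis lam_gt1 : 1 < `|lam|.
Variables (gl : 'cV[R]_d -> 'cV[R]_d) (g : eisom R d) (phi : fm_pi1 Y -> fm_pi1 Y).
Hypothesis glE : forall x, gl x = eisom_act g (lam *: x).
Hypothesis gl_phi : forall p x, gl (fm_act p x) = fm_act (phi p) (gl x).

Let lam0 : lam != 0.
Proof. by rewrite -normr_gt0; exact: lt_trans lam_gt1. Qed.

Definition contraction (x : 'cV[R]_d) : 'cV[R]_d := lam^-1 *: eisom_act g^-1%g x.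

Lemma contractionK m : cancel (iter m gl) (iter m contraction).
Proof.
elim: m => [|m IH] x //; rewrite iterSr iterS [contraction _]/contraction glE.
by rewrite eisom_actK scalerA mulVf // scale1r IH.
Qed.

Lemma contractionVK m : cancel (iter m contraction) (iter m gl).
Proof.
elim: m => [|m IH] x //; rewrite iterSr iterS [contraction _]/contraction glE.
by rewrite scalerA divff // scale1r eisom_actVK IH.
Qed.

Lemma gl_iter_phi m p x :
  iter m gl (fm_act p x) = fm_act (iter m phi p) (iter m gl x).
Proof. by elim: m => //= m ->. Qed.

Lemma contraction_phi m p x :
  iter m contraction (fm_act (iter m phi p) x) = fm_act p (iter m contraction x).
Proof. by rewrite -{1}(contractionVK m x) -gl_iter_phi contractionK. Qed.

Lemma enorm_le_contraction m r x y : enorm_le r (x - y) ->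
  enorm_le (`|lam| ^- m * r) (iter m contraction x - iter m contraction y).
Proof.
move=> xy; elim: m => [|m IH] /=; first by rewrite expr0 invr1 mul1r.
rewrite exprS invfM -mulrA -scalerBr -normfV; apply: enorm_leZ.
exact: enorm_le_act.
Qed.

Lemma enorm_le_gl m r x y : enorm_le r (x - y) ->
  enorm_le (`|lam| ^+ m * r) (iter m gl x - iter m gl y).
Proof.
move=> xy; elim: m => [|m IH] /=; first by rewrite expr0 mul1r.
rewrite exprS -mulrA !glE; apply: enorm_le_act; rewrite -scalerBr.
exact: enorm_leZ.
Qed.

End expanding_endomorphism.

Section deck_action.
Variables (R : realType) (d : nat) (Y : flat_manifold R d).
Implicit Types p q : fm_pi1 Y.

Lemma fm_actM p q x : fm_act (p * q)%g x = fm_act p (fm_act q x).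
Proof. exact: eisom_actM. Qed.

Lemma fm_act1 x : fm_act (1%g : fm_pi1 Y) x = x.
Proof. exact: eisom_act1. Qed.

Lemma fm_actK p : cancel (fm_act p) (fm_act p^-1%g).
Proof. by move=> x; rewrite -fm_actM mulVg fm_act1. Qed.

Lemma fm_actVK p : cancel (fm_act p^-1%g) (fm_act p).
Proof. by move=> x; rewrite -fm_actM mulgV fm_act1. Qed.

Lemma fm_act_finite (c : 'cV[R]_d) r :
  finite_set [set p : fm_pi1 Y | exists2 y : 'cV[R]_d, `|y - c| <= r & `|fm_act p y - c| <= r].
Proof.
have := finite_preimage _ (deck_ball_finite Y c r).
move=> /(_ _ (@pi1_eisom _ _ Y)) fin; apply: sub_finite_set (fin _) => [p [y yr pyr]|].
  by split; [exact: valP p | exists y].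
by move=> p q _ _; exact: val_inj.
Qed.

Lemma fm_act_cobounded (c : 'cV[R]_d) : exists r : R,
  forall x, exists p : fm_pi1 Y, `|fm_act p x - c| <= r.
Proof.
have [r hr] := deck_cobounded Y c; exists r => x.
by have [p Sp pr] := hr x; exists (FmPi1 Sp).
Qed.

End deck_action.

(** * The odometer space *)

Lemma discrete_compact_finite (T : choiceType) (A : set (discrete_topology T)) :
  compact A -> finite_set (A : set T).
Proof.
move=> /compact_near_coveringP cA.
(* The filter of all sufficiently large sets, ordered by inclusion of finite sets: each point
   eventually belongs, hence by compactness all of [A] does, already to some finite set. *)
pose F : set_system (set T) :=
  filter_from [set B : set T | finite_set B] (fun B => [set C | B `<=` C]).
have FF : Filter F.
  apply: filter_from_filter; first by exists set0; exact: finite_set0.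
  move=> B C fB fC; exists (B `|` C); first by rewrite /= finite_setU.
  by move=> D BCD; split => x ?; apply: BCD; [left | right].
have [|B fB /(_ B) AB] := cA _ F (fun B => B) FF.
  move=> x _; exists ([set x], [set C : set T | C x]) => /=.
    split; first exact: discrete_set1.
    exists [set x]; first exact: finite_set1.
    by move=> C; apply.
  by move=> [y C] /= [-> Cx].
by apply: sub_finite_set fB; apply: AB.
Qed.

Section odometer_topology.
Variables (Gam : groupType) (phi : Gam -> Gam).
Local Notation Omega := (odometer_space phi).
Local Notation cosets := (prod_topology (fun _ : nat => discrete_topology (set Gam))).

Lemma coset_seq_near (w : cosets) m : nbhs w [set v : cosets | v m = w m].
Proof.
have /= := @proj_continuous nat (fun=> discrete_topology (set Gam)) m w.
by move=> /(_ [set w m] (discrete_set1 _)).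
Qed.

Lemma odometer_near (w : Omega) m :
  nbhs w [set v : Omega | val v m = val w m].
Proof.
exact: (@initial_continuous Omega _ set_val w _ (coset_seq_near (val w) m)).
Qed.

Lemma odometer_val_ex (w : Omega) m : exists x, val w m = left_coset (tower phi m) x.
Proof. by have [x [-> _]] := set_valP w m; exists x. Qed.

Lemma odometer_seq_closed : closed (odometer_seq phi).
Proof.
have -> : odometer_seq phi = \bigcap_m [set w | exists x : Gam,
     w m = left_coset (tower phi m) x /\ w m.+1 = left_coset (tower phi m.+1) x].
  by apply/seteqP; split => [w ww m _|w ww m]; [exact: ww | exact: (ww m I)].
apply: closed_bigI => m _; rewrite -openC openE => w nw.
have c : nbhs w ([set v : cosets | v m = w m] `&` [set v | v m.+1 = w m.+1]).
  by apply: filterI; exact: coset_seq_near.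
apply: filterS c => v /= [vm vm1] [x [e1 e2]]; apply: nw; exists x.
by rewrite -e1 -e2 vm vm1.
Qed.

Lemma odometer_compact : (forall m, finite_set (coset_space (tower phi m))) ->
  compact [set: Omega].
Proof.
move=> fin.
have cK : compact [set w : cosets | forall m, coset_space (tower phi m) (w m)].
  pose A m : set (discrete_topology (set Gam)) := coset_space (tower phi m).
  apply: (@tychonoff nat (fun=> discrete_topology (set Gam)) A) => m.
  exact: (@finite_compact (discrete_topology (set Gam)) (A m) (fin m)).
have cO : compact (odometer_seq phi).
  apply: subclosed_compact odometer_seq_closed cK _ => w ww m.
  by have [x [-> _]] := ww m; exists x.
(* Compactness passes from the subset to the subtype by taking cluster points of the image
   filter. *)
move=> F FF _.
have PF : ProperFilter (set_val @ F) by exact: fmap_proper_filter.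
have FO : (set_val @ F) (odometer_seq phi).
  change (F (set_val @^-1` odometer_seq phi)).
  by rewrite (_ : _ @^-1` _ = setT); [exact: filterT|apply/seteqP; split=> v // _; exact: set_valP].
have [w [ww clw]] := cO (set_val @ F) PF FO.
exists (SigSub (mem_set ww)); split => // A B FA [_ [[C oC <-] Cw] CB].
have FA' : (set_val @ F) (set_val @` A).
  by change (F (set_val @^-1` (set_val @` A))); apply: filterS FA => v Av; exists v.
have [] := clw (set_val @` A) C FA'.
  by apply: open_nbhs_nbhs; split => //; move: Cw; rewrite /= set_valE.
move=> _ [[v Av <-] Cv]; exists v; split => //; exact: CB.
Qed.

Hypothesis fin : forall m, finite_set (coset_space (tower phi m)).

Lemma odometer_precompact_finite (A : set (garr (odometer phi))) :
  precompact A -> finite_set ([set a.1 | a in A] : set Gam).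
Proof.
rewrite precompactE => cA.
have cfst : continuous (fst : garr (odometer phi) -> discrete_topology Gam).
  by move=> x; exact: cvg_fst.
have /discrete_compact_finite := continuous_compact (continuous_subspaceT cfst) cA.
by apply: sub_finite_set => _ [a Aa <-]; exists a => //; exact: subset_closure.
Qed.

Lemma finite_odometer_precompact (A : set (garr (odometer phi))) (B : set Gam) :
  finite_set B -> (forall a, A a -> B a.1) -> precompact A.
Proof.
move=> fB AB.
pose B' : set (discrete_topology Gam) := B.
have cB : compact (B' `*` [set: Omega]).
  apply: compact_setX; last exact: odometer_compact.
  exact: (@finite_compact (discrete_topology Gam) B' fB).
have clB : closed (B' `*` [set: Omega]).
  rewrite -openC openE => a Ba.
  exists ([set a.1], setT).
    by split; [exact: discrete_set1 | exact: filterT].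
  by move=> b /= [ab _] [Bb _]; apply: Ba; rewrite /= -ab.
apply: (@precompact_subset (garr (odometer phi)) A (B' `*` [set: Omega])).
  by move=> a Aa; split => //; exact: AB.
by rewrite precompact_closed.
Qed.

End odometer_topology.

(** * The dynamic asymptotic dimension *)

Section tower_cosets.
Variables (Gam : groupType) (phi : Gam -> Gam).
Hypothesis phiM : forall p q, phi (p * q)%g = (phi p * phi q)%g.

Lemma iter_morph m p q : iter m phi (p * q)%g = (iter m phi p * iter m phi q)%g.
Proof. by elim: m => //= m ->; rewrite phiM. Qed.

Lemma iter_morph1 m : iter m phi 1%g = 1%g.
Proof. by apply: (mulgI (iter m phi 1%g)); rewrite -iter_morph !mulg1. Qed.

Lemma iter_morphV m p : iter m phi p^-1%g = (iter m phi p)^-1%g.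
Proof.
by apply: (mulgI (iter m phi p)); rewrite -iter_morph !mulgV iter_morph1.
Qed.

Lemma left_coset_refl m x : left_coset (tower phi m) x x.
Proof.
exists 1%g; last by rewrite mulg1.
by exists 1%g => //; exact: iter_morph1.
Qed.

Lemma left_coset_tower m x q :
  left_coset (tower phi m) (x * iter m phi q)%g = left_coset (tower phi m) x.
Proof.
apply/seteqP; split => _ [_ [p _ <-] <-].
  by exists (iter m phi (q * p)%g); [exists (q * p)%g | rewrite iter_morph mulgA].
exists (iter m phi (q^-1 * p)%g); first by exists (q^-1 * p)%g.
by rewrite iter_morph iter_morphV mulgA mulgK.
Qed.

Lemma left_coset_towerP m x y : left_coset (tower phi m) x y ->
  exists q, y = (x * iter m phi q)%g.
Proof. by move=> [_ [q _ <-] <-]; exists q. Qed.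

Lemma odometer_space_nonempty : [set: odometer_space phi] !=set0.
Proof.
have h : (fun m => left_coset (tower phi m) 1%g) \in odometer_seq phi.
  by apply/mem_set => m; exists 1%g.
by exists (SigSub h).
Qed.

End tower_cosets.

Lemma finite_nat_ub (R : realType) (T : choiceType) (A : set T) (f : T -> R) :
  finite_set A -> exists c : nat, forall x, A x -> f x <= c%:R.
Proof.
move=> /finite_seqP[s ->]; elim: s => [|a s [c hc]]; first by exists 0%N.
exists (maxn (Num.truncn (f a)).+1 c) => x /=; rewrite inE => /orP[/eqP->|/hc h].
  apply: le_trans (ltW (truncnS_gt _)) _.
  by rewrite ler_nat leq_maxl.
by apply: le_trans h _; rewrite ler_nat leq_maxr.
Qed.

(** * Upper bound, from invariant covers of Euclidean space *)

Section odometer_upper_bound.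
Variables (R : realType) (d : nat) (Y : flat_manifold R d) (lam : R).
Hypothesis lam_ge2 : 2 <= `|lam|.
Variables (gl : 'cV[R]_d -> 'cV[R]_d) (g : eisom R d) (phi : fm_pi1 Y -> fm_pi1 Y).
Hypothesis glE : forall x, gl x = eisom_act g (lam *: x).
Hypothesis gl_phi : forall p x, gl (fm_act p x) = fm_act (phi p) (gl x).

Let lam_gt1 : 1 < `|lam|. Proof. by apply: lt_le_trans lam_ge2; rewrite ltr1n. Qed.
Let lam_gt0 : 0 < `|lam|. Proof. exact: lt_trans lam_gt1. Qed.
Local Notation ctr m := (iter m (contraction lam g)).

Lemma fm_act_free (p q : fm_pi1 Y) x : fm_act p x = fm_act q x -> p = q.
Proof.
move=> pq; have h : (q^-1 * p)%g = 1%g.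
  apply: val_inj; apply: (@deck_free _ _ Y _ x); first exact: valP.
  by rewrite -[LHS]/(fm_act (q^-1 * p)%g x) fm_actM pq fm_actK.
by move/(congr1 (mulg q)): h; rewrite mulKVg mulg1.
Qed.

(** Both sides move [gl 0] to the same point, and the action is free. *)
Lemma expanding_morph p q : phi (p * q)%g = (phi p * phi q)%g.
Proof.
apply: (@fm_act_free _ _ (gl 0)).
by rewrite -gl_phi !fm_actM !gl_phi.
Qed.

Let phiM := expanding_morph.

Lemma enorm_le_expand m r x y : enorm_le r (ctr m x - ctr m y) ->
  enorm_le (`|lam| ^+ m * r) (x - y).
Proof.
by move=> /(enorm_le_gl glE m); rewrite !(contractionVK lam_gt1 glE).
Qed.

(** Since [gl] carries the deck action to that of its image under [phi], the tower orbits all meet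
    one ball. So each coset contains some [p] with [p^-1 0] in that ball, which leaves finitely many
    [p]. *)
Lemma tower_finite_index m : finite_set (coset_space (tower phi m)).
Proof.
have [r hr] := fm_act_cobounded Y 0.
pose B := `|lam| ^+ m * (d%:R * r) + `|iter m gl 0|.
have r0 : 0 <= r by have [p] := hr 0; exact: le_trans.
have B0 : 0 <= B by rewrite addr_ge0 // mulr_ge0 // ?exprn_ge0 // mulr_ge0.
have fin := fm_act_finite Y 0 B.
apply: sub_finite_set (finite_image (fun p => left_coset (tower phi m) p^-1%g) fin).
move=> _ [x _ <-].
have [q qr] := hr (ctr m (fm_act x^-1%g 0)).
exists (iter m phi q * x^-1)%g; last first.
  by rewrite invMg invgK -iter_morphV // left_coset_tower.
exists 0; first by rewrite subrr normr0.
move: qr; rewrite !subr0 -(contraction_phi lam_gt1 glE gl_phi) -fm_actM => qr.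
have : enorm_le (d%:R * r) (ctr m (fm_act (iter m phi q * x^-1)%g 0) - ctr m (iter m gl 0)).
  by rewrite (contractionK lam_gt1 glE) subr0; exact: norm_enorm_le.
move/enorm_le_expand/enorm_le_norm => h.
rewrite -[fm_act _ _](subrK (iter m gl 0)); apply: le_trans (ler_normD _ _) _.
by rewrite lerD2r.
Qed.

Lemma odometer_dad_le : dad_le (odometer phi) d.
Proof.
move=> K oK pK.
have fS := odometer_precompact_finite pK; set S := [set a.1 | a in K] in fS.
have [eps [D [eps0 D0 [W [E [cov inv]]]]]] := invariant_separated_cover Y.
case: cov => cW symE trE sepE diamE.
have [m hm'] : exists m : nat, forall s : fm_pi1 Y, S s ->
    d%:R * `|0 - fm_act s^-1%g 0| <= m%:R * eps.
  have [c hc] := finite_nat_ub (fun s => d%:R * `|0 - fm_act s^-1%g 0| / eps) fS.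
  by exists c => s /hc; rewrite ler_pdivrMr.
(* The linear bound suffices because [m <= 2 ^+ m <= |lam| ^+ m]. *)
have hm (s : fm_pi1 Y) : S s -> `|lam| ^- m * (d%:R * `|0 - fm_act s^-1%g 0|) <= eps.
  move=> /hm' h; rewrite ler_pdivrMl ?exprn_gt0 //; apply: le_trans h _.
  rewrite ler_pM2r //; apply: (@le_trans _ _ (2 ^+ m)).
    by rewrite -natrX ler_nat ltnW // ltn_expl.
  by rewrite lerXn2r // ?nnegrE ?ler0n.
pose pt (p : fm_pi1 Y) := ctr m (fm_act p^-1%g (0 : 'cV[R]_d)).
(* Changing [p] within its coset moves [pt p] within its deck orbit, so by invariance of [W]
   membership in [U i] does not depend on the representative. *)
have ptM p q : pt (p * iter m phi q)%g = fm_act q^-1%g (pt p).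
  rewrite /pt invMg -iter_morphV // fm_actM.
  by rewrite (contraction_phi lam_gt1 glE gl_phi).
pose U i : set (odometer_space phi) :=
  [set w | exists2 p, val w m p & W i (pt p)].
have UW i w : U i w -> forall p, val w m p -> W i (pt p).
  move=> [p wp Wp] q wq; have [x xw] := odometer_val_ex w m.
  move: wp wq; rewrite xw => /left_coset_towerP[a pa] /left_coset_towerP[b qb].
  have -> : q = (p * iter m phi (a^-1 * b)%g)%g.
    by rewrite iter_morph // iter_morphV // pa qb mulgA mulgK.
  by rewrite ptM; apply: inv => //; exact: valP.
have ne (w : odometer_space phi) : exists p, val w m p.
  have [x ->] := odometer_val_ex w m; exists x; exact: left_coset_refl.
exists U; split.
- move=> i; rewrite openE => w [p wp Wp].
  have := odometer_near w m; apply: filterS => v vw.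
  by exists p => //; have -> : val v m = val w m := vw.
- move=> w _; have [p wp] := ne w; have [i _ Wi] := cW (pt p) I.
  by exists i => //; exists p.
move=> i.
(* The arrows that stay in one piece. All representatives [p] are required at once, since invariance
   under the deck group is known for [W] and not for [E]. *)
pose H : set (garr (odometer phi)) :=
  [set a | forall p, val (a.2 : odometer_space phi) m p ->
     E i (pt p) (pt ((a.1 : fm_pi1 Y) * p)%g)].
exists H; split.
- split.
    move=> [h w] /= Hhw p /= [q wq <-]; apply: symE.
    by rewrite mulKg; exact: Hhw.
  move=> [h w] [h' w'] /= Ha Hb e p /= wp; rewrite -mulgA.
  apply: trE (Hb _ wp) _; apply: Ha.
  by rewrite [w]e /=; exists p.
(* Undoing the contraction, a piece of diameter [D] at scale [m] bounds the displacement of 0 under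
   [h^-1] by [B]. *)
- pose B := `|lam| ^+ m * D.
  have B0 : 0 <= B by rewrite mulr_ge0 // exprn_ge0.
  have fin := finite_image (fun p => p^-1%g) (fm_act_finite Y 0 B).
  apply: (finite_odometer_precompact tower_finite_index fin) => -[h w] Hh /=.
  exists h^-1%g; last exact: invgK.
  exists 0; first by rewrite subrr normr0.
  have [p wp] := ne w; have [_ /enorm_le_expand] := diamE _ _ _ (Hh p wp).
  move=> /(enorm_le_act (pi1_eisom p)) /enorm_le_norm.
  rewrite -!/(fm_act _ _) /pt /= invMg fm_actM !fm_actVK.
  by rewrite distrC.
move=> [s w] [/= Ksw Us Ur] p wp.
apply: sepE; first exact: UW Us _ wp.
  by apply: UW Ur _ _; rewrite /=; exists p.
rewrite /pt invMg fm_actM.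
have Ss : S s by exists (s, w).
apply: enorm_leW (hm _ Ss) _; apply: enorm_le_contraction.
by apply: enorm_le_act; exact: norm_enorm_le.
Qed.

End odometer_upper_bound.

(* A coarse form of Lebesgue's covering theorem for N^(n+1). *)
Lemma unbounded_color_class (n k D : nat) (c : ('I_n.+1 -> nat) -> 'I_k)
    (E : ('I_n.+1 -> nat) -> ('I_n.+1 -> nat) -> Prop) :
  (k <= n.+1)%N ->
  (forall x y, E x y -> E y x) ->
  (forall x y z, E x y -> E y z -> E x z) ->
  (forall x y, c x = c y -> (forall i, `|(x i)%:Z - (y i)%:Z| <= 1) -> E x y) ->
  exists x y i, E x y /\ D%:Z < `|(x i)%:Z - (y i)%:Z|.
Proof.
move=> kn symE trE adjE; apply: contrapT => noE.
have close x y i : E x y -> `|(x i)%:Z - (y i)%:Z| <= D%:Z.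
  by move=> xy; rewrite leNgt; apply/negP => h; apply: noE; exists x, y, i.
have refl x : E x x by apply: adjE => // i; rewrite subrr.
(* The choice is made from the class as a set, so equivalent points get the same representative. *)
pose rep x : 'I_n.+1 -> nat := get [set y | E x y].
have repE x : E x (rep x) by apply: (@getPex _ [set y | E x y]); exists x.
have rep_eq x y : E x y -> rep x = rep y.
  move=> xy; congr get; apply/seteqP; split => z /=; first exact: trE (symE _ _ xy).
  exact: trE xy.
have [|s [y inj]] := @no_small_collapse n D (fun x i => (rep x i)%:Z).
  by move=> x i; rewrite distrC; exact: close.
(* There are n + 2 vertices and at most n + 1 colours; two vertices of one colour are neighbours,
   hence share a representative. *)
suff : injective (fun a : 'I_n.+2 => c (grid_vertex s y a)).
  by move/leq_card; rewrite !card_ord; lia.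
move=> a b cab; apply/eqP; apply: contrapT => /negP /inj; apply.
apply/funext => i; congr (Posz (_ i)); apply: rep_eq; apply: adjE => // j.
by rewrite /grid_vertex; case: (_ < _)%N; case: (_ < _)%N; lia.
Qed.

(** * Lower bound, from colourings of the integer lattice *)

Section odometer_lower_bound.
Variables (R : realType) (d : nat) (Y : flat_manifold R d).
Variable phi : fm_pi1 Y -> fm_pi1 Y.
Hypothesis tower_fin : forall m, finite_set (coset_space (tower phi m)).

Lemma odometer_dad_ge n : dad_le (odometer phi) n -> (d <= n)%N.
Proof.
move=> dadn; rewrite leqNgt; apply/negP => lt_nd.
have [r hr] := fm_act_cobounded Y 0.
have r0 : 0 <= r by have [p] := hr 0; exact: le_trans.
have [w _] := odometer_space_nonempty phi.
pose vec (x : 'I_d -> nat) : 'cV[R]_d := \col_i (x i)%:R.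
(* [q x] brings the lattice point [x] near 0, so [(q x)^-1 0] stays at bounded distance from it. *)
pose q x := projT1 (cid (hr (vec x))).
have qr x : enorm_le (d%:R * r) (vec x - fm_act (q x)^-1%g 0).
  have := projT2 (cid (hr (vec x))); rewrite -/(q x) => /norm_enorm_le.
  move/(enorm_le_act (pi1_eisom (q x)^-1%g)).
  by rewrite -!/(fm_act _ _) fm_actK.
have vecE x y (B : R) : enorm_le B (fm_act (q x)^-1%g 0 - fm_act (q y)^-1%g 0) ->
    enorm_le (d%:R * r + (B + d%:R * r)) (vec x - vec y).
  move=> xy; apply: (enorm_le_trans (qr x)); last exact: lexx.
  by apply: (enorm_le_trans xy (enorm_le_sub (qr y))).
have qvec x y (B : R) : enorm_le B (vec x - vec y) ->
    enorm_le (d%:R * r + (B + d%:R * r)) (fm_act (q x)^-1%g 0 - fm_act (q y)^-1%g 0).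
  move=> xy; apply: (enorm_le_trans (enorm_le_sub (qr x))); last exact: lexx.
  by apply: (enorm_le_trans xy (qr y)).
have q_dist x y (B : R) : enorm_le B (fm_act (q x)^-1%g 0 - fm_act (q y)^-1%g 0) <->
    enorm_le B (fm_act (q y * (q x)^-1)%g 0 - 0).
  split.
    move=> /(enorm_le_act (pi1_eisom (q y))); rewrite -!/(fm_act _ _).
    by rewrite fm_actVK fm_actM.
  move=> /(enorm_le_act (pi1_eisom (q y)^-1%g)); rewrite -!/(fm_act _ _).
  by rewrite fm_actM fm_actK.
(* Lattice neighbours differ by at most 1 in sup norm, hence [d * 1] in Euclidean norm, and each
   passage between [x] and [(q x)^-1 0] costs [d * r]. Thus the arrows between neighbours lie in
   [K]. *)
pose rho := d%:R * r + (d%:R * 1 + d%:R * r).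
have rho0 : 0 <= rho by rewrite !addr_ge0 // mulr_ge0.
pose S : set (fm_pi1 Y) := [set s | `|fm_act s 0 - 0| <= rho].
have fS : finite_set S.
  apply: sub_finite_set (fm_act_finite Y 0 rho) => s Ss.
  by exists 0 => //; rewrite subrr normr0.
pose K : set (garr (odometer phi)) := [set a | S a.1].
have oK : open K.
  rewrite openE => a Ka; exists ([set a.1], setT).
    by split; [exact: discrete_set1 | exact: filterT].
  by move=> b [/= ba _]; rewrite /K /= ba; exact: Ka.
have pK : precompact K by apply: finite_odometer_precompact fS _.
have [U [oU cU hU]] := dadn K oK pK.
pose pt x : odometer_space phi := odometer_act (q x) w.
have ptE x y : odometer_act (q y * (q x)^-1)%g (pt x) = pt y.
  by rewrite /pt -odometer_actM mulgKV.
(* The unit arrows belong to [K], so the sets [U i] cover the orbit. *)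
have ptU x : exists i, U i (pt x).
  have [|i _ Ui] := cU (pt x); last by exists i.
  by left; exists (1%g : fm_pi1 Y, pt x) => //=; rewrite /K /S /= fm_act1 subrr normr0.
pose c x := projT1 (cid (ptU x)).
have cP x : U (c x) (pt x) := projT2 (cid (ptU x)).
pose H i := projT1 (cid (hU i)).
have [Hsub Hpre HU] : [/\ forall i, subgroupoid (H i), forall i, precompact (H i) &
    forall i, [set a | [/\ K a, U i (gsrc a) & U i (grng a)]] `<=` H i].
  by split => i; have [] := projT2 (cid (hU i)).
pose arrow x y : garr (odometer phi) := ((q y * (q x)^-1)%g : fm_pi1 Y, pt x).
pose E x y := c x = c y /\ H (c x) (arrow x y).
have arrowV x y : ginv (arrow x y) = arrow y x.
  by rewrite /arrow /= ptE invMg invgK.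
have arrowM x y z : gmul (arrow y z) (arrow x y) = arrow x z.
  by rewrite /arrow /= mulgA mulgKV.
have [B hB] : exists B : nat, forall i a, H i a -> `|fm_act (a.1 : fm_pi1 Y) 0 - 0| <= B%:R.
  have h i := finite_nat_ub (fun s : fm_pi1 Y => `|fm_act s 0 - 0|)
    (odometer_precompact_finite (Hpre i)).
  pose b i := projT1 (cid (h i)).
  exists (\max_i b i) => i a Ha.
  apply: (@le_trans _ _ (b i)%:R); last by rewrite ler_nat leq_bigmax.
  by apply: (projT2 (cid (h i))); exists a.
case: (posnP d) => [d0|d_gt0]; first by rewrite d0 in lt_nd.
have [m dm] : exists m, d = m.+1 by exists d.-1; rewrite prednK.
(* Arrows in the precompact [H i] displace 0 by at most [B]; back on the lattice, points related by
   [E] differ by less than [D]. *)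
pose D := (Num.truncn (d%:R * r + (d%:R * B%:R + d%:R * r))).+1.
have : exists x y i, E x y /\ D%:Z < `|(x i)%:Z - (y i)%:Z|.
  have := @unbounded_color_class m n.+1 D; rewrite -dm => lem.
  apply: (lem c) => //.
  - move=> x y [cxy Hxy]; split => //; rewrite -cxy -arrowV.
    exact: (proj1 (Hsub _)).
  - move=> x y z [cxy Hxy] [cyz Hyz]; split; first by rewrite cxy.
    rewrite -(arrowM _ y); apply: (proj2 (Hsub _)) => //; first by rewrite cxy.
    by rewrite /= ptE.
  - move=> x y cxy xy; split => //.
    have hxy : enorm_le rho (fm_act (q y * (q x)^-1)%g 0 - 0).
      apply: (proj1 (q_dist x y rho)); apply: qvec; apply: norm_enorm_le.
      apply: cV_norm_le => // i; rewrite !mxE.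
      by have := xy i; rewrite -(ler_int R) intr_norm intrB.
    apply: HU; split.
    + exact: enorm_le_norm hxy.
    + exact: cP.
    + by rewrite /= ptE cxy; exact: cP.
move=> [x [y [i [[cxy Hxy] ltD]]]].
have hxy : enorm_le (d%:R * B%:R) (fm_act (q y * (q x)^-1)%g 0 - 0).
  exact: norm_enorm_le (hB _ _ Hxy).
have xy := enorm_le_norm (vecE _ _ _ (proj2 (q_dist x y _) hxy)).
have : D%:R < `|vec x - vec y|.
  apply: lt_le_trans (cV_norm_ge _ i); rewrite !mxE.
  by move: ltD; rewrite -(ltr_int R) intr_norm intrB.
apply/negP; rewrite -leNgt; apply: le_trans xy _.
by apply: ltW; exact: truncnS_gt.
Qed.

End odometer_lower_bound.

Lemma dad_eq (G : topGroupoid) (n : nat) :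
  dad_le G n -> (forall m, dad_le G m -> (n <= m)%N) -> dad G = Some n.
Proof.
move=> Gn nG; rewrite /dad; case: pselect => [h|[]]; last by exists n.
congr Some; case: ex_minnP => m /asboolP Gm mmin.
by apply/eqP; rewrite eqn_leq mmin ?nG //; apply/asboolP.
Qed.

Theorem lemma3p4 (R : realType) (d : nat) (Y : flat_manifold R d) (k : int)
    (k_expanding : 1 < `|k * (fm_holonomy_order Y)%:Z + 1|)
    (g : fm_space Y -> fm_space Y)
    (g_proj : forall x : 'cV[R]_d,
       g (fm_proj Y x) =
       fm_proj Y ((k * (fm_holonomy_order Y)%:Z + 1)%:~R *: x))
    (x0 : 'cV[R]_d) (x0_fixed : g (fm_proj Y x0) = fm_proj Y x0)
    (gstar : fm_pi1 Y -> fm_pi1 Y) (gstarP : is_pi1_map g x0 gstar) :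
  dad (odometer gstar) = Some (fm_dim Y).
Proof.
set lam : R := (k * (fm_holonomy_order Y)%:Z + 1)%:~R in g_proj.
have [gl [gl_cont gl_lift _ gl_phi]] := gstarP.
(* [lam] is an integer, so absolute value above 1 means at least 2. *)
have lam_ge2 : 2 <= `|lam|.
  by rewrite /lam -intr_norm (ler_int R 2) -lezD1 // in k_expanding *.
have [h _ glE] := lift_affine gl_cont (fun x => etrans (gl_lift x) (g_proj x)).
apply: dad_eq; first exact: (odometer_dad_le lam_ge2 glE gl_phi).
by move=> m; apply: odometer_dad_ge; exact: (tower_finite_index lam_ge2 glE gl_phi).
Qed.
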